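(* Let $E/\mathbb{Q}$ be an elliptic curve of Mordell--Weil rank $r>0$, with $M_E=E(\mathbb{Q})/E(\mathbb{Q})_{\mathrm{tors}}$ and height torus $\mathcal{T}_E=V_E/M_E$. Let $\lambda_1\le\cdots\le\lambda_r$ be the successive minima of $M_E$ with respect to the norm $\|P\|^2=\widehat h_E(P)$. The systole of $\mathcal{T}_E$ satisfies $$\operatorname{sys}(\mathcal{T}_E)^2=\min_{0\ne P\in M_E}\widehat h_E(P)=\lambda_1^2.$$ More generally, for each $1\le i\le r$, $\lambda_i^2$ is the least $H$ for which $M_E$ contains $i$ linearly independent classes of height at most $H$.
   Context: For an elliptic curve $E/\mathbb{Q}$, $M_E:=E(\mathbb{Q})/E(\mathbb{Q})_{\mathrm{tors}}$ is free abelian of finite rank $r$. $\widehat h_E$ is the canonical (N\'eron--Tate) height in the Cremona/PARI normalization, i.e. $\widehat h_E(P)=\lim_{n\to\infty}4^{-n}h(x(2^nP))$ with $h$ the logarithmic Weil height on $\mathbb{P}^1(\mathbb{Q})$ (twice the height in Silverman's normalization). The pairing $\langle P,Q\rangle_E=\frac12(\widehat h_E(P+Q)-\widehat h_E(P)-\widehat h_E(Q))$ descends to $M_E$ and extends $\mathbb{R}$-bilinearly to a positive-definite inner product on $V_E:=M_E\otimes_{\mathbb{Z}}\mathbb{R}$. The height torus is $\mathcal{T}_E:=V_E/M_E$ with the quotient flat Riemannian metric. The systole $\operatorname{sys}(\mathcal{T}_E)$ is the least length of a noncontractible closed curve in $\mathcal{T}_E$. The $i$-th successive minimum $\lambda_i$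 is the least $\lambda$ such that the closed ball of radius $\lambda$ in $(V_E,\|\cdot\|)$ contains $i$ linearly independent vectors of $M_E$. *)

(* Defs.v *)
From HB Require Import structures.
From mathcomp Require Import all_boot all_order all_algebra finmap.
From mathcomp Require Import all_classical all_reals all_analysis.
From mathcomp Require Import ring.
(* Only the notations of [monalg] are incompatible with the above. *)
From mathcomp.multinomials Require Import -(notations) monalg.

Set Implicit Arguments.
Unset Strict Implicit.
Unset Printing Implicit Defensive.

Import Order.TTheory GRing.Theory Num.Theory.
Import numFieldNormedType.Exports.

Local Open Scope classical_set_scope.
Local Open Scope ring_scope.
Local Open Scope quotient_scope.

(* The chord-and-tangent law on y^2 = x^3 + A x^2 + B x + C, with [None] the
   point at infinity. A general Weierstrass equation is brought to this form
   by completing the square; the only purpose of this section is to obtain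
   the group axioms. *)
Section CompletedCubic.
Variables (F : fieldType) (A B C : F).
Hypothesis F2 : 2 != 0 :> F.
Hypothesis nonsing : forall x : F,
  x ^+ 3 + A * x ^+ 2 + B * x + C = 0 -> 3 * x ^+ 2 + 2 * A * x + B != 0.

Implicit Types P Q S : option (F * F).

Definition cc_on P : bool :=
  if P is Some (x, y) then y ^+ 2 == x ^+ 3 + A * x ^+ 2 + B * x + C else true.
Definition cc_opp P := if P is Some (x, y) then Some (x, - y) else None.
Definition cc_add P Q :=
  match P, Q with
  | None, _ => Q
  | _, None => P
  | Some (x1, y1), Some (x2, y2) =>
    if (x1 == x2) && (y1 + y2 == 0) then None else
    let l := if x1 == x2 then (3 * x1 ^+ 2 + 2 * A * x1 + B) / (2 * y1)
             else (y2 - y1) / (x2 - x1) in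
    let x3 := l ^+ 2 - A - x1 - x2 in
    Some (x3, - (y1 + l * (x3 - x1)))
  end.

Let cc_out x1 y1 x2 l : option (F * F) :=
  Some (l ^+ 2 - A - x1 - x2, - (y1 + l * (l ^+ 2 - A - x1 - x2 - x1))).

Let same_x x y1 y2 : cc_on (Some (x, y1)) -> cc_on (Some (x, y2)) ->
  y1 + y2 != 0 -> y1 = y2.
Proof.
move=> /eqP e1 /eqP e2 n; apply/eqP; rewrite -subr_eq0.
have : (y1 - y2) * (y1 + y2) == 0 by rewrite -subr_sqr e1 e2 subrr.
by rewrite mulf_eq0 (negbTE n) orbF.
Qed.

Let double_neq0 (y : F) : (2 * y == 0) = (y == 0).
Proof. by rewrite mulf_eq0 (negbTE F2). Qed.

Let cc_addE x1 y1 x2 y2 l :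
  cc_on (Some (x1, y1)) -> cc_on (Some (x2, y2)) ->
  ~~ ((x1 == x2) && (y1 + y2 == 0)) ->
  y2 = y1 + l * (x2 - x1) ->
  (x1 = x2 -> 2 * y1 * l = 3 * x1 ^+ 2 + 2 * A * x1 + B) ->
  cc_add (Some (x1, y1)) (Some (x2, y2)) = cc_out x1 y1 x2 l.
Proof.
move=> o1 o2 n e t /=; rewrite (negbTE n).
case: eqP n => [E|/eqP ne] /=; last first.
  by rewrite e [y1 + _]addrC addrK mulfK // subr_eq0 eq_sym.
subst x2 => n.
have E := same_x o1 o2 n; subst y2.
rewrite -(t erefl) [2 * y1 * l]mulrC mulfK //.
by rewrite mulr_natl mulr2n; move: n; rewrite -E.
Qed.

Let cc_line x1 y1 x2 y2 :
  cc_on (Some (x1, y1)) -> cc_on (Some (x2, y2)) ->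
  ~~ ((x1 == x2) && (y1 + y2 == 0)) ->
  exists l, [/\ y2 = y1 + l * (x2 - x1),
    x1 = x2 -> 2 * y1 * l = 3 * x1 ^+ 2 + 2 * A * x1 + B,
    B = 2 * l * (y1 - l * x1) + x1 * x2 + (x1 + x2) * (l ^+ 2 - A - x1 - x2),
    C = (y1 - l * x1) ^+ 2 - x1 * x2 * (l ^+ 2 - A - x1 - x2) &
    cc_add (Some (x1, y1)) (Some (x2, y2)) = cc_out x1 y1 x2 l].
Proof.
move=> o1 o2 n.
have [l e t] : exists2 l, y2 = y1 + l * (x2 - x1) &
    x1 = x2 -> 2 * y1 * l = 3 * x1 ^+ 2 + 2 * A * x1 + B.
  have [E|ne] := eqVneq x1 x2.
    subst x2; rewrite eqxx /= in n.
    have E := same_x o1 o2 n; subst y2.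
    exists ((3 * x1 ^+ 2 + 2 * A * x1 + B) / (2 * y1)).
      by rewrite subrr mulr0 addr0.
    by move=> _; rewrite mulrC divfK // mulr_natl mulr2n.
  exists ((y2 - y1) / (x2 - x1)); last by move=> E; rewrite E eqxx in ne.
  by rewrite divfK ?subrKC // subr_eq0 eq_sym.
exists l.
have eB : B = 2 * l * (y1 - l * x1) + x1 * x2
              + (x1 + x2) * (l ^+ 2 - A - x1 - x2).
  have [E|ne] := eqVneq x1 x2.
    subst x2.
    have h : B = 2 * y1 * l - 3 * x1 ^+ 2 - 2 * A * x1 by rewrite (t erefl); ring.
    by rewrite {1}h; ring.
  have d : x2 - x1 != 0 by rewrite subr_eq0 eq_sym.
  apply: (mulfI d).
  move: (o1) (o2) => /eqP e1 /eqP e2.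
  have -> : (x2 - x1) * B = y2 ^+ 2 - y1 ^+ 2 - (x2 ^+ 3 - x1 ^+ 3)
                            - A * (x2 ^+ 2 - x1 ^+ 2).
    by rewrite e1 e2; ring.
  by rewrite e; ring.
split => //; last exact: cc_addE.
have -> : C = y1 ^+ 2 - x1 ^+ 3 - A * x1 ^+ 2 - B * x1.
  by move: (o1) => /eqP ->; ring.
by rewrite eB; ring.
Qed.
Lemma cc_add_on P Q : cc_on P -> cc_on Q -> cc_on (cc_add P Q).
Proof.
case: P Q => [[x1 y1]|] [[x2 y2]|] // o1 o2.
have [/= -> //|n] := boolP ((x1 == x2) && (y1 + y2 == 0)).
have [l [e t eB eC ->]] := cc_line o1 o2 n.
by apply/eqP; ring: eB eC.
Qed.

Lemma cc_opp_on P : cc_on P -> cc_on (cc_opp P).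
Proof. by case: P => [[x y]|] //=; rewrite sqrrN. Qed.

Lemma cc_oppK : involutive cc_opp.
Proof. by case=> [[x y]|] //=; rewrite opprK. Qed.

Lemma cc_addC P Q : cc_on P -> cc_on Q -> cc_add P Q = cc_add Q P.
Proof.
case: P Q => [[x1 y1]|] [[x2 y2]|] // o1 o2.
have [z|n] := boolP ((x1 == x2) && (y1 + y2 == 0)).
  by move: (z) => /=; rewrite z [x2 == x1]eq_sym [y2 + y1]addrC z.
have [l [e t eB eC ->]] := cc_line o1 o2 n.
rewrite (cc_addE o2 o1 (l := l)).
- by congr (Some (_, _)); ring: e.
- by rewrite eq_sym addrC.
- by ring: e.
- by move=> E; rewrite E -(t (esym E)) e E; ring.
Qed.

Lemma cc_add0 P : cc_add None P = P. Proof. by []. Qed.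
Lemma cc_addr0 P : cc_add P None = P. Proof. by case: P => [[]|]. Qed.

Lemma cc_addN P : cc_add (cc_opp P) P = None.
Proof. by case: P => [[x y]|] //=; rewrite eqxx addNr eqxx. Qed.

Lemma cc_addrN P : cc_add P (cc_opp P) = None.
Proof. by rewrite -{1}[P]cc_oppK cc_addN. Qed.

Lemma cc_oppD P Q : cc_on P -> cc_on Q ->
  cc_opp (cc_add P Q) = cc_add (cc_opp P) (cc_opp Q).
Proof.
case: P Q => [[x1 y1]|] [[x2 y2]|] // o1 o2.
have [z|n] := boolP ((x1 == x2) && (y1 + y2 == 0)).
  by move: (z) => /=; rewrite z -opprD oppr_eq0 z.
have [l [e t eB eC ->]] := cc_line o1 o2 n.
rewrite (cc_addE (cc_opp_on o1) (cc_opp_on o2) (l := - l)).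
- by congr (Some (_, _)); ring.
- by rewrite -opprD oppr_eq0.
- by rewrite e; ring.
- by move=> E; rewrite -(t E); ring.
Qed.

Lemma cc_addK P Q : cc_on P -> cc_on Q -> cc_add (cc_add P Q) (cc_opp Q) = P.
Proof.
case: P Q => [[x1 y1]|] [[x2 y2]|] // o1 o2; last by rewrite cc_add0 cc_addrN.
have [z|n] := boolP ((x1 == x2) && (y1 + y2 == 0)).
  rewrite [cc_add (Some _) _]/= z /=.
  by case/andP: z => /eqP -> /eqP /(canRL (addrK _)) ->; rewrite sub0r.
have [l [e t eB eC eS]] := cc_line o1 o2 n.
have oS := cc_add_on o1 o2; rewrite eS /cc_out in oS *.
set X := l ^+ 2 - A - x1 - x2 in oS eB eC *.
have nz : ~~ ((X == x2) && (- (y1 + l * (X - x1)) - y2 == 0)).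
  apply/negP => /andP[/eqP EX /eqP Ey].
  have y20 : y2 = 0.
    apply/eqP; rewrite -double_neq0; apply/eqP; apply: oppr_inj.
    by rewrite oppr0 -Ey e EX; ring.
  have y10 : y1 = - l * (x2 - x1) by move: y20; rewrite e => /(canRL (addrK _)) ->; ring.
  have A' : A = l ^+ 2 - x1 - x2 - x2 by rewrite -{2}EX /X; ring.
  have f0 : x2 ^+ 3 + A * x2 ^+ 2 + B * x2 + C = 0.
    by move: o2 => /= /eqP <-; rewrite y20 expr0n.
  move: (nonsing f0); rewrite eB EX A' y10 => /eqP; apply; ring.
rewrite (cc_addE oS (cc_opp_on o2) nz (l := - l)).
- by congr (Some (_, _)); rewrite /X; ring: e.
- by rewrite e; ring.
move=> EX.
have A' : A = l ^+ 2 - x1 - x2 - x2 by rewrite -{2}EX /X; ring.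
by rewrite eB EX A'; ring.
Qed.

Lemma cc_same_x x y1 y2 : cc_on (Some (x, y1)) -> cc_on (Some (x, y2)) ->
  y2 = y1 \/ y2 = - y1.
Proof.
move=> o1 o2; have [z|n] := eqVneq (y1 + y2) 0; [right|left].
  by apply/eqP; rewrite -addr_eq0 addrC z.
by rewrite (same_x o1 o2).
Qed.

Let cc_assoc_gen x1 y1 x2 y2 x3 y3 X1 Y1 X3 Y3 :
  let P := Some (x1, y1) in let Q := Some (x2, y2) in let S := Some (x3, y3) in
  cc_on P -> cc_on Q -> cc_on S ->
  x1 != x2 -> x2 != x3 -> x1 != x3 ->
  cc_add P Q = Some (X1, Y1) -> cc_add Q S = Some (X3, Y3) ->
  X1 != x3 -> x1 != X3 ->
  cc_add (cc_add P Q) S = cc_add P (cc_add Q S).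
Proof.
move=> P Q S /eqP e1 /eqP e2 /eqP e3 n12 n23 n13.
have d12 : x2 - x1 != 0 by rewrite subr_eq0 eq_sym.
have d23 : x3 - x2 != 0 by rewrite subr_eq0 eq_sym.
have d13 : x3 - x1 != 0 by rewrite subr_eq0 eq_sym.
rewrite /P /Q /S /= (negbTE n12) (negbTE n23) /=.
set l := (y2 - y1) / (x2 - x1); set m := (y3 - y2) / (x3 - x2).
have el : y2 - y1 = l * (x2 - x1) by rewrite divfK.
have em : y3 - y2 = m * (x3 - x2) by rewrite divfK.
have ey1 : y1 = y2 - l * (x2 - x1) by rewrite -el subKr.
have ey3 : y3 = y2 + m * (x3 - x2) by rewrite -em subrKC.
have eA : A = (m * (y3 + y2) - l * (y2 + y1)) / (x3 - x1) - x1 - x2 - x3.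
  have -> : m * (y3 + y2) = (y3 ^+ 2 - y2 ^+ 2) / (x3 - x2).
    by rewrite subr_sqr /m mulrAC.
  have -> : l * (y2 + y1) = (y2 ^+ 2 - y1 ^+ 2) / (x2 - x1).
    by rewrite subr_sqr /l mulrAC.
  by rewrite e1 e2 e3; field; rewrite d12 d23 d13.
move: l m {el em} ey1 ey3 eA => l m ey1 ey3 eA.
move=> [<- _] [<- _] n1 n3; rewrite (negbTE n1) (negbTE n3) /=.
set D1 := x3 - (l ^+ 2 - A - x1 - x2).
set D3 := m ^+ 2 - A - x2 - x3 - x1.
have {n1} : D1 != 0 by rewrite subr_eq0 eq_sym.
have {n3} : D3 != 0 by rewrite subr_eq0 eq_sym.
rewrite /D1 /D3 {D1 D3 e1 e2 e3} eA ey3 ey1 => n3 n1.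
have k1 := mulf_neq0 n1 d13; have k3 := mulf_neq0 n3 d13.
congr (Some (_, _)); field; rewrite d13 /=; apply/andP; split;
  by [move: k1; congr (_ != 0); field; rewrite d13
     | move: k3; congr (_ != 0); field; rewrite d13].
Qed.

Let cc_double_gen x1 y1 x2 y2 X1 Y1 X3 Y3 :
  let P := Some (x1, y1) in let Q := Some (x2, y2) in
  cc_on P -> cc_on Q -> y1 != 0 -> x1 != x2 ->
  cc_add P P = Some (X1, Y1) -> cc_add P Q = Some (X3, Y3) ->
  X1 != x2 -> x1 != X3 ->
  cc_add (cc_add P P) Q = cc_add P (cc_add P Q).
Proof.
move=> P Q /eqP e1 /eqP e2 y10 n12.
have d12 : x2 - x1 != 0 by rewrite subr_eq0 eq_sym.
have y1D : y1 + y1 != 0 by rewrite -mulr2n -mulr_natl double_neq0.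
have y2D : 2 * y1 != 0 by rewrite double_neq0.
rewrite /P /Q /= eqxx (negbTE n12) (negbTE y1D) /=.
set l := (_ / (2 * y1)).
have el : 2 * y1 * l = 3 * x1 ^+ 2 + 2 * A * x1 + B by rewrite mulrC divfK.
have eA : A = ((y2 ^+ 2 - y1 ^+ 2) / (x2 - x1) - 2 * y1 * l) / (x2 - x1)
              - 2 * x1 - x2.
  by rewrite el e1 e2; field.
move: l el eA => l _ eA.
move=> [<- _] [<- _] n1 n3; rewrite (negbTE n1) (negbTE n3) /=.
set D1 := x2 - (l ^+ 2 - A - x1 - x1).
set D3 := ((y2 - y1) / (x2 - x1)) ^+ 2 - A - x1 - x2 - x1.
have {n1} : D1 != 0 by rewrite subr_eq0 eq_sym.
have {n3} : D3 != 0 by rewrite subr_eq0 eq_sym.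
rewrite /D1 /D3 {D1 D3} eA => n3 n1.
have k1 := mulf_neq0 n1 (mulf_neq0 d12 d12).
have k3 := mulf_neq0 n3 (mulf_neq0 d12 d12).
congr (Some (_, _)); field; rewrite d12 /=; apply/andP; split;
  by [move: k1; congr (_ != 0); field; rewrite d12
     | move: k3; congr (_ != 0); field; rewrite d12].
Qed.

Let cc_addKl P Q : cc_on P -> cc_on Q ->
  cc_add (cc_opp P) (cc_add P Q) = Q.
Proof.
move=> oP oQ; rewrite [cc_add P Q]cc_addC // cc_addC ?cc_opp_on ?cc_add_on //.
exact: cc_addK.
Qed.

Let cc_addNK P Q : cc_on P -> cc_on Q -> cc_add (cc_add P (cc_opp Q)) Q = P.
Proof.
by move=> oP oQ; have := cc_addK oP (cc_opp_on oQ); rewrite cc_oppK.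
Qed.

Let cc_add_eqN P Q S : cc_on P -> cc_on Q -> cc_add P Q = S ->
  P = cc_add S (cc_opp Q).
Proof. by move=> oP oQ <-; rewrite cc_addK. Qed.

Let cc_gen P Q S : cc_on P -> cc_on Q -> cc_on S ->
  P != None -> Q != None -> S != None ->
  P != Q -> P != cc_opp Q -> Q != S -> Q != cc_opp S ->
  P != S -> P != cc_opp S ->
  cc_add P Q != S -> cc_add P Q != cc_opp S ->
  P != cc_add Q S -> P != cc_opp (cc_add Q S) ->
  cc_add (cc_add P Q) S = cc_add P (cc_add Q S).
Proof.
have neqx x1 y1 x2 y2 : cc_on (Some (x1, y1)) -> cc_on (Some (x2, y2)) ->
    Some (x1, y1) != Some (x2, y2) ->
    Some (x1, y1) != cc_opp (Some (x2, y2)) -> x1 != x2.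
  move=> o1 o2 n1 n2; apply/eqP => E; subst x2.
  by case: (cc_same_x o2 o1) => E; subst y1; rewrite eqxx in n1 n2.
case: P Q S => [[x1 y1]|] [[x2 y2]|] [[x3 y3]|] // o1 o2 o3 _ _ _.
move=> a1 a2 a3 a4 a5 a6.
case E1: (cc_add _ _) (cc_add_on o1 o2) => [[X1 Y1]|] oX1; last first.
  by have := cc_add_eqN o1 o2 E1; rewrite cc_add0 => E; rewrite E eqxx in a2.
case E3: (cc_add (Some (x2, y2)) _) (cc_add_on o2 o3) => [[X3 Y3]|] oX3;
    last first.
  by have := cc_add_eqN o2 o3 E3; rewrite cc_add0 => E; rewrite E eqxx in a4.
move=> a7 a8 a9 a10; rewrite -E1 -E3.
by apply: (cc_assoc_gen o1 o2 o3 _ _ _ E1 E3); apply: neqx; eassumption.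
Qed.

Let cc_double_ns P Q : cc_on P -> cc_on Q -> cc_add P P != Q ->
  cc_add (cc_add P P) Q = cc_add P (cc_add P Q).
Proof.
move=> oP oQ nPPQ.
have [-> //|P0] := eqVneq P None.
have [->|Q0] := eqVneq Q None; first by rewrite !cc_addr0.
have [e|n1] := eqVneq P (cc_opp P).
  rewrite {2}e cc_addrN [cc_add P Q]cc_addC //.
  by rewrite [RHS]cc_addC ?cc_add_on // {2}e cc_addK.
have [e|n2] := eqVneq P Q; first by rewrite -e cc_addC ?cc_add_on.
have [e|n3] := eqVneq P (cc_opp Q).
  have -> : Q = cc_opp P by rewrite e cc_oppK.
  by rewrite cc_addK // cc_addrN cc_addr0.
have [e|n4] := eqVneq (cc_add P P) (cc_opp Q).
  have -> : Q = cc_opp (cc_add P P) by rewrite e cc_oppK.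
  rewrite cc_addrN cc_oppD //.
  rewrite [cc_add P (cc_add (cc_opp P) _)]cc_addC ?cc_add_on ?cc_opp_on //.
  by rewrite cc_addNK ?cc_opp_on // cc_addrN.
have neqx x1 y1 x2 y2 : cc_on (Some (x1, y1)) -> cc_on (Some (x2, y2)) ->
    Some (x1, y1) != Some (x2, y2) ->
    Some (x1, y1) != cc_opp (Some (x2, y2)) -> x1 != x2.
  move=> o1 o2 m1 m2; apply/eqP => E; subst x2.
  by case: (cc_same_x o2 o1) => E; subst y1; rewrite eqxx in m1 m2.
case: P Q oP oQ P0 Q0 nPPQ n1 n2 n3 n4
  => [[x1 y1]|] [[x2 y2]|] // o1 o2 _ _ a1 a2 a3 a4 a5.
have y10 : y1 != 0.
  by apply: contraNneq a2 => ->; rewrite /= oppr0.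
case E1: (cc_add _ (Some (x1, y1))) a1 a5 (cc_add_on o1 o1)
  => [[X1 Y1]|] a1 a5 oX1; last first.
  by have := cc_add_eqN o1 o1 E1; rewrite cc_add0 => E; rewrite -E eqxx in a2.
case E3: (cc_add _ (Some (x2, y2))) (cc_add_on o1 o2) => [[X3 Y3]|] oX3;
    last first.
  by have := cc_add_eqN o1 o2 E3; rewrite cc_add0 => E; rewrite E eqxx in a4.
rewrite -E1 -E3; apply: (cc_double_gen o1 o2 y10 _ E1 E3).
- by apply: neqx; eassumption.
- by apply: neqx; eassumption.
apply: (neqx _ y1 _ Y3) => //; apply/eqP => E.
  move: E3; rewrite -E cc_addC // => /(cc_add_eqN o2 o1).
  by rewrite cc_addrN.
move: E3; rewrite cc_addC // => /(cc_add_eqN o2 o1).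
rewrite -[Some (X3, Y3)]cc_oppK -E -cc_oppD // E1 => E'.
by move: a5; rewrite E' cc_oppK eqxx.
Qed.

Let cc_double P Q : cc_on P -> cc_on Q ->
  cc_add (cc_add P P) Q = cc_add P (cc_add P Q).
Proof.
move=> oP oQ; have [<-|] := eqVneq (cc_add P P) Q; last exact: cc_double_ns.
set D := cc_add P P; have oD : cc_on D by apply: cc_add_on.
have oN := cc_opp_on oP.
have [e|n] := eqVneq (cc_add D D) (cc_opp P).
  have eP : P = cc_add (cc_opp D) (cc_opp D) by rewrite -cc_oppD // e cc_oppK.
  have -> : cc_add P D = cc_opp D by rewrite {1}eP cc_addNK ?cc_opp_on.
  by rewrite e /D cc_oppD // cc_addC ?cc_add_on // cc_addNK.
have eD : cc_add D (cc_opp P) = P by rewrite /D cc_addK.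
have := cc_double_ns oD oN n; rewrite eD => /(congr1 (cc_add^~ P)).
rewrite /= cc_addNK ?cc_add_on // => ->.
by rewrite [cc_add D P]cc_addC // [RHS]cc_addC ?cc_add_on.
Qed.

Let cc_assoc_sum P Q : cc_on P -> cc_on Q ->
  cc_add (cc_add P Q) (cc_add P Q) = cc_add P (cc_add Q (cc_add P Q)).
Proof.
move=> oP oQ; set S := cc_add P Q; have oS : cc_on S by apply: cc_add_on.
have := cc_double oS (cc_opp_on oP).
have -> : cc_add S (cc_opp P) = Q by rewrite /S [cc_add P Q]cc_addC // cc_addK.
move=> /(congr1 (cc_add^~ P)); rewrite /= cc_addNK ?cc_add_on // => ->.
by rewrite [cc_add S Q]cc_addC // [RHS]cc_addC ?cc_add_on.
Qed.

Lemma cc_addA P Q S : cc_on P -> cc_on Q -> cc_on S ->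
  cc_add (cc_add P Q) S = cc_add P (cc_add Q S).
Proof.
move=> oP oQ oS.
have [nP nQ nS] := And3 (cc_opp_on oP) (cc_opp_on oQ) (cc_opp_on oS).
have [-> //|P0] := eqVneq P None.
have [->|Q0] := eqVneq Q None; first by rewrite cc_addr0.
have [->|S0] := eqVneq S None; first by rewrite !cc_addr0.
have [->|n1] := eqVneq P Q; first exact: cc_double.
have [->|n2] := eqVneq P (cc_opp Q); first by rewrite cc_addN cc_addKl.
have [->|n3] := eqVneq Q S.
  rewrite [RHS]cc_addC ?cc_add_on // cc_double // cc_addC ?cc_add_on //.
  by rewrite [cc_add P S]cc_addC.
have [->|n4] := eqVneq Q (cc_opp S); first by rewrite cc_addNK // cc_addN cc_addr0.
have [->|n5] := eqVneq P S.
  by rewrite [LHS]cc_addC ?cc_add_on // [cc_add S Q]cc_addC.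
have [->|n6] := eqVneq P (cc_opp S).
  rewrite [cc_add _ Q]cc_addC // cc_addNK // [cc_add Q S]cc_addC //.
  by rewrite cc_addKl.
have [<-|n7] := eqVneq (cc_add P Q) S; first exact: cc_assoc_sum.
have [e|n8] := eqVneq (cc_add P Q) (cc_opp S).
  have -> : S = cc_add (cc_opp P) (cc_opp Q) by rewrite -cc_oppD // e cc_oppK.
  rewrite -cc_oppD // cc_addrN cc_oppD // [cc_add Q _]cc_addC ?cc_add_on //.
  by rewrite cc_addNK // cc_addrN.
have [->|n9] := eqVneq P (cc_add Q S).
  rewrite [cc_add Q S]cc_addC // cc_assoc_sum // [RHS]cc_addC ?cc_add_on //.
  by rewrite [cc_add Q _]cc_addC ?cc_add_on.
have [->|n10] := eqVneq P (cc_opp (cc_add Q S)); last exact: cc_gen.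
rewrite cc_addN [cc_add Q S]cc_addC // cc_oppD // cc_addNK //.
exact: cc_addN.
Qed.

End CompletedCubic.

(* Weierstrass models over Q; the last field is the nonvanishing of the
   discriminant. *)
Record elliptic_curve := EllipticCurve {
  a1 : rat; a2 : rat; a3 : rat; a4 : rat; a6 : rat;
  _ : let b2 := a1 ^+ 2 + 4 * a2 in
      let b4 := 2 * a4 + a1 * a3 in
      let b6 := a3 ^+ 2 + 4 * a6 in
      let b8 := a1 ^+ 2 * a6 + 4 * a2 * a6 - a1 * a3 * a4 + a2 * a3 ^+ 2
                - a4 ^+ 2 in
      - b2 ^+ 2 * b8 - 8 * b4 ^+ 3 - 27 * b6 ^+ 2 + 9 * b2 * b4 * b6 != 0
}.

Section RationalPoints.
Variable E : elliptic_curve.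
Local Notation a1 := (a1 E).
Local Notation a2 := (a2 E).
Local Notation a3 := (a3 E).
Local Notation a4 := (a4 E).
Local Notation a6 := (a6 E).

Definition on_curve (P : option (rat * rat)) : bool :=
  if P is Some (x, y) then
    y ^+ 2 + a1 * x * y + a3 * y == x ^+ 3 + a2 * x ^+ 2 + a4 * x + a6
  else true.

(* E(Q); [None] is the point at infinity. *)
Record point := Point { coords : option (rat * rat); _ : on_curve coords }.

HB.instance Definition _ := [isSub for coords].
HB.instance Definition _ := [Choice of point by <:].

Definition opp_coords (P : option (rat * rat)) :=
  if P is Some (x, y) then Some (x, - y - a1 * x - a3) else None.

Definition add_coords (P Q : option (rat * rat)) :=
  match P, Q with
  | None, _ => Q
  | _, None => P
  | Some (x1, y1), Some (x2, y2) =>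
    if (x1 == x2) && (y1 + y2 + a1 * x2 + a3 == 0) then None else
    let l := if x1 == x2 then
               (3 * x1 ^+ 2 + 2 * a2 * x1 + a4 - a1 * y1)
               / (2 * y1 + a1 * x1 + a3)
             else (y2 - y1) / (x2 - x1) in
    let x3 := l ^+ 2 + a1 * l - a2 - x1 - x2 in
    let y3 := y1 + l * (x3 - x1) in
    Some (x3, - y3 - a1 * x3 - a3)
  end.

Let A := (a1 ^+ 2 + 4 * a2) / 4.
Let B := (2 * a4 + a1 * a3) / 2.
Let C := (a3 ^+ 2 + 4 * a6) / 4.

Let two_neq0 : 2 != 0 :> rat. Proof. by []. Qed.

Let nonsing (x : rat) : x ^+ 3 + A * x ^+ 2 + B * x + C = 0 ->
  3 * x ^+ 2 + 2 * A * x + B != 0.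
Proof.
move=> e; apply/eqP => e'; case: E @A @B @C e e' => /= c1 c2 c3 c4 c6.
set b2 := c1 ^+ 2 + 4 * c2; set b4 := 2 * c4 + c1 * c3.
set b6 := c3 ^+ 2 + 4 * c6; set b8 := c1 ^+ 2 * c6 + _ - _ + _ - _.
have : 4 * b8 = b2 * b6 - b4 ^+ 2 by rewrite /b8 /b2 /b4 /b6; ring.
move: b8 b6 b4 b2 => b8 b6 b4 b2 e8 /eqP D e e'; apply: D.
have e4 : b4 = - 6 * x ^+ 2 - b2 * x.
  apply/eqP; rewrite -subr_eq0; apply/eqP.
  by rewrite -[RHS](mulr0 2) -e'; field.
have e6 : b6 = - 4 * x ^+ 3 - b2 * x ^+ 2 - 2 * b4 * x.
  apply/eqP; rewrite -subr_eq0; apply/eqP.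
  by rewrite -[RHS](mulr0 4) -e; field.
apply: (mulfI (_ : 4 != 0 :> rat)) => //.
have -> : 4 * (- b2 ^+ 2 * b8 - 8 * b4 ^+ 3 - 27 * b6 ^+ 2 + 9 * b2 * b4 * b6)
        = - b2 ^+ 2 * (4 * b8) - 32 * b4 ^+ 3 - 108 * b6 ^+ 2
          + 36 * b2 * b4 * b6 by ring.
by rewrite e8 e6 e4; ring.
Qed.

Let phi (P : option (rat * rat)) : option (rat * rat) :=
  if P is Some (x, y) then Some (x, y + (a1 * x + a3) / 2) else None.

Let phi_inj : injective phi.
Proof. by move=> [[x y]|] [[x' y']|] //= [-> /addIr ->]. Qed.

Let phi_on P : cc_on A B C (phi P) = on_curve P.
Proof.
case: P => [[x y]|] //=; rewrite -subr_eq0 -[RHS]subr_eq0.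
by congr (_ == 0); rewrite /A /B /C; field.
Qed.

Let phi_opp P : phi (opp_coords P) = cc_opp (phi P).
Proof. by case: P => [[x y]|] //=; congr (Some (_, _)); field. Qed.

Let phi_add P Q : on_curve P -> on_curve Q ->
  phi (add_coords P Q) = cc_add A B (phi P) (phi Q).
Proof.
case: P Q => [[x1 y1]|] [[x2 y2]|] //; rewrite -!phi_on => oP oQ /=.
have [E12|n12] := eqVneq x1 x2; last first.
  have d12 : x2 - x1 != 0 by rewrite subr_eq0 eq_sym.
  by congr (Some (_, _)); rewrite /A; field.
subst x2; have -> : y1 + y2 + a1 * x1 + a3
    = y1 + (a1 * x1 + a3) / 2 + (y2 + (a1 * x1 + a3) / 2) by field.
case: eqP => //= /eqP n.
have e : y1 = y2.
  apply: (addIr ((a1 * x1 + a3) / 2)).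
  by case: (cc_same_x oQ oP) => // e; rewrite e addNr eqxx in n.
subst y2; have d : 2 * y1 + a1 * x1 + a3 != 0.
  by move: n; congr (_ != 0); field.
have d' : 2 * (y1 + (a1 * x1 + a3) / 2) != 0 by move: d; congr (_ != 0); field.
congr (Some (_, _)); rewrite /A /B; field;
  by move: d; congr (_ != 0); ring.
Qed.

Let opp_on P : on_curve P -> on_curve (opp_coords P).
Proof. by rewrite -!phi_on phi_opp; exact: cc_opp_on. Qed.

Let add_on P Q : on_curve P -> on_curve Q -> on_curve (add_coords P Q).
Proof.
move=> oP oQ; rewrite -phi_on phi_add //.
by apply: cc_add_on; rewrite ?phi_on.
Qed.

Definition point_zero : point := @Point None isT.
Definition point_opp (P : point) : point := Point (opp_on (valP P)).
Definition point_add (P Q : point) : point := Point (add_on (valP P) (valP Q)).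

Let point_addC : commutative point_add.
Proof.
move=> P Q; apply/val_inj/phi_inj; rewrite !phi_add ?valP //.
by apply: (@cc_addC _ A B C); rewrite phi_on valP.
Qed.

Let point_addA : associative point_add.
Proof.
move=> P Q S; apply/val_inj/phi_inj.
rewrite !(phi_add, valP, add_on) //.
by apply/esym/(cc_addA two_neq0 nonsing); rewrite phi_on valP.
Qed.

Let point_add0 : left_id point_zero point_add.
Proof. by move=> P; apply/val_inj. Qed.

Let point_addN : left_inverse point_zero point_opp point_add.
Proof.
move=> P; apply/val_inj/phi_inj; rewrite phi_add ?valP ?opp_on //.
by rewrite phi_opp cc_addN.
Qed.

HB.instance Definition _ :=
  GRing.isZmodule.Build point point_addA point_addC point_add0 point_addN.

Definition is_torsion : {pred point} :=
  fun P => `[< exists2 n : nat, (0 < n)%N & P *+ n = 0 >].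

Fact is_torsion_zmod_closed : zmod_closed is_torsion.
Proof.
split=> [|P Q]; first by apply/asboolP; exists 1%N.
move=> /asboolP[m m0 Pm] /asboolP[n n0 Qn]; apply/asboolP.
exists (m * n)%N; first by rewrite muln_gt0 m0.
by rewrite mulrnBl mulrnA Pm mul0rn mulnC mulrnA Qn mul0rn subrr.
Qed.
HB.instance Definition _ :=
  GRing.isZmodClosed.Build point is_torsion is_torsion_zmod_closed.

(* M_E = E(Q) / E(Q)_tors *)
Definition mordell_weil : Type := Quotient.quot is_torsion.
HB.instance Definition _ := Choice.on mordell_weil.
HB.instance Definition _ := GRing.Zmodule.on mordell_weil.

(* [mordell_weil E] is free abelian of rank [r]. *)
Definition mordell_weil_rank (r : nat) : Prop :=
  exists b : 'I_r -> mordell_weil, forall P : mordell_weil,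
    exists! c : {ffun 'I_r -> int}, P = \sum_(j < r) b j *~ c j.

End RationalPoints.

Section LinearIndependence.
Variable i : nat.

Definition int_independent (M : zmodType) (P : 'I_i -> M) : Prop :=
  forall c : 'I_i -> int, \sum_(j < i) P j *~ c j = 0 -> forall j, c j = 0.

Definition lin_independent (K : pzRingType) (V : lmodType K) (u : 'I_i -> V) :
    Prop :=
  forall c : 'I_i -> K, \sum_(j < i) c j *: u j = 0 -> forall j, c j = 0.

End LinearIndependence.

(* M \otimes_Z R, as the quotient of the free R-module on M by the R-span of
   the elements [P + Q] - [P] - [Q]. *)
Section Realification.
Variables (R : realType) (M : zmodType).

Definition gen (P : M) : malg M R := mkmalgU P 1.

Definition additivity_relation : {pred malg M R} := fun x =>
  `[< exists s : seq (R * (M * M)),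
        x = \sum_(t <- s) t.1 *: (gen (t.2.1 + t.2.2) - gen t.2.1 - gen t.2.2) >].

Fact additivity_relation_submod_closed : submod_closed additivity_relation.
Proof.
split=> [|a x y /asboolP[s ->] /asboolP[s' ->]].
  by apply/asboolP; exists [::]; rewrite big_nil.
apply/asboolP; exists ([seq (a * t.1, t.2) | t <- s] ++ s').
rewrite big_cat big_map scaler_sumr; apply: (congr1 (+%R^~ _)).
by apply: eq_bigr => t _; rewrite scalerA.
Qed.
HB.instance Definition _ := GRing.isSubmodClosed.Build R (malg M R)
  additivity_relation additivity_relation_submod_closed.

Definition realification : Type := Quotient.quot additivity_relation.
HB.instance Definition _ := Choice.on realification.
HB.instance Definition _ := GRing.Zmodule.on realification.
HB.instance Definition _ := EqQuotient.on realification.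

Local Notation V := realification.

Definition real_scale (a : R) (v : V) : V := \pi_V (a *: repr v).

Let pi_scale (a : R) (x : malg M R) : real_scale a (\pi_V x) = \pi_V (a *: x).
Proof.
apply/eqP; rewrite -[_ == _]/(_ == _ %[mod Quotient.quot additivity_relation]).
rewrite -Quotient.idealrBE -scalerBr rpredZ // Quotient.idealrBE.
by rewrite reprK.
Qed.

Let piD (x y : malg M R) : \pi_V (x + y) = \pi_V x + \pi_V y.
Proof. exact: raddfD. Qed.

Let real_scaleA a b v : real_scale a (real_scale b v) = real_scale (a * b) v.
Proof. by elim/quotW: v => x; rewrite [real_scale b _]pi_scale !pi_scale scalerA. Qed.

Let real_scale1 : left_id 1 real_scale.
Proof. by elim/quotW=> x; rewrite pi_scale scale1r. Qed.

Let real_scaleDr : right_distributive real_scale +%R.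
Proof.
by move=> a; elim/quotW=> x; elim/quotW=> y; rewrite -piD !pi_scale scalerDr.
Qed.

Let real_scaleDl v : {morph real_scale^~ v : a b / a + b}.
Proof. by move=> a b; elim/quotW: v => x; rewrite !pi_scale scalerDl. Qed.

HB.instance Definition _ := GRing.Zmodule_isLmodule.Build R realification
  real_scaleA real_scale1 real_scaleDr real_scaleDl.

(* P |-> P (x) 1 *)
Definition realify (P : M) : realification := \pi_V (gen P).

Fact realify_is_zmod_morphism : zmod_morphism realify.
Proof.
have D P Q : realify (P + Q) = realify P + realify Q.
  apply/eqP; rewrite -piD.
  rewrite -[_ == _]/(_ == _ %[mod Quotient.quot additivity_relation]).
  rewrite -Quotient.idealrBE opprD addrA; apply/asboolP.
  by exists [:: (1, (P, Q))]; rewrite big_seq1 scale1r.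
by move=> P Q; apply: (addIr (realify Q)); rewrite -D !subrK.
Qed.
HB.instance Definition _ := GRing.isZmodMorphism.Build M realification realify
  realify_is_zmod_morphism.

(* The R-bilinear extension of a pairing on M, computed on representatives of
   the classes; it does not depend on them when [b] is biadditive. *)
Definition bilinear_extension (b : M -> M -> R) (v w : realification) : R :=
  \sum_(P <- msupp (repr v)) \sum_(Q <- msupp (repr w))
    mcoeff P (repr v) * mcoeff Q (repr w) * b P Q.

End Realification.

Definition is_least (R : realType) (A : set R) (x : R) : Prop :=
  A x /\ lbound A x.

(* The logarithmic Weil height on P^1(Q), with [None] the point at infinity. *)
Definition weil_height (R : realType) (x : option rat) : R :=
  if x is Some q then ln (maxn `|numq q| `|denq q|)%:R else 0.

Section HeightTorus.
Variables (R : realType) (E : elliptic_curve).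

Definition canonical_height (P : point E) : R :=
  limn (fun n => (4 ^+ n)^-1 *
                 weil_height R (omap fst (coords (P *+ (2 ^ n)%N)))).

(* The value on any representative, heights being invariant under torsion. *)
Definition height (P : mordell_weil E) : R := canonical_height (repr P).

Definition height_pairing (P Q : mordell_weil E) : R :=
  (height (P + Q) - height P - height Q) / 2.

Definition height_space : Type := realification R (mordell_weil E).
HB.instance Definition _ := GRing.Lmodule.on height_space.
HB.instance Definition _ := EqQuotient.on height_space.

Definition height_norm (v : height_space) : R :=
  Num.sqrt (bilinear_extension height_pairing v v).

Definition lattice : {pred height_space} :=
  fun v => `[< exists P : mordell_weil E, v = realify R P >].

Fact lattice_zmod_closed : zmod_closed lattice.
Proof.
split=> [|v w /asboolP[P ->] /asboolP[Q ->]]; apply/asboolP.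
  by exists 0; rewrite raddf0.
by exists (P - Q); rewrite raddfB.
Qed.
HB.instance Definition _ :=
  GRing.isZmodClosed.Build height_space lattice lattice_zmod_closed.

Definition height_torus : Type := Quotient.quot lattice.
HB.instance Definition _ := Choice.on height_torus.
HB.instance Definition _ := GRing.Zmodule.on height_torus.
HB.instance Definition _ := EqQuotient.on height_torus.

(* The Riemannian distance of the quotient flat metric. *)
Definition torus_dist (x y : height_torus) : R :=
  inf [set d | exists v w : height_space,
    [/\ \pi_height_torus v = x, \pi_height_torus w = y
      & d = height_norm (v - w)]].

Definition torus_open (U : set height_torus) : Prop :=
  forall x, U x -> exists2 e : R, 0 < e & forall y, torus_dist x y < e -> U y.

Let torus_openT : torus_open setT.
Proof. by move=> x _; exists 1. Qed.

Let torus_openI U W : torus_open U -> torus_open W -> torus_open (U `&` W).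
Proof.
move=> oU oW x [/oU[d d0 dU] /oW[e e0 eW]].
exists (Num.min d e) => [|y]; first by rewrite lt_min d0.
by rewrite lt_min => /andP[/dU ? /eW].
Qed.

Let torus_open_bigU (I : Type) (f : I -> set height_torus) :
  (forall i, torus_open (f i)) -> torus_open (\bigcup_i f i).
Proof.
by move=> of_ x [i _ /of_[e e0 eU]]; exists e => // y /eU ?; exists i.
Qed.

HB.instance Definition _ := isOpenTopological.Build height_torus
  torus_openT torus_openI torus_open_bigU.

Definition closed_curve (g : R -> height_torus) : Prop :=
  {within `[0, 1], continuous g} /\ g 0 = g 1.

(* Free null-homotopy of a closed curve. *)
Definition contractible_curve (g : R -> height_torus) : Prop :=
  exists (H : R * R -> height_torus) (x : height_torus),
    [/\ {within `[0, 1] `*` `[0, 1], continuous H},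
        forall t, t \in `[0, 1] -> H (t, 0) = g t,
        forall t, t \in `[0, 1] -> H (t, 1) = x
      & forall s, s \in `[0, 1] -> H (0, s) = H (1, s)].

Definition polygonal_length (g : R -> height_torus) (s : seq R) : R :=
  \sum_(0 <= n < size s) torus_dist (g (nth 1 (0 :: s) n)) (g (nth 1 s n)).

(* The length for the Riemannian distance; it is infinite when [g] is not
   rectifiable. *)
Definition curve_length (g : R -> height_torus) : \bar R :=
  ereal_sup [set (polygonal_length g s)%:E | s in itv_partition 0 1].

Definition noncontractible_lengths : set R :=
  [set l | exists g : R -> height_torus,
     [/\ closed_curve g, ~ contractible_curve g & curve_length g = l%:E]].

Definition systole : R := inf noncontractible_lengths.

(* The radii [l] for which the closed ball of radius [l] contains [i] linearly
   independent lattice vectors. *)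
Definition minimum_radii (i : nat) : set R :=
  [set l | exists u : 'I_i -> height_space,
     [/\ lin_independent u, forall j, u j \in lattice
       & forall j, height_norm (u j) <= l]].

Definition successive_minimum (i : nat) : R := inf (minimum_radii i).

End HeightTorus.

(* Main.v *)
Require Import Defs.
From HB Require Import structures.
From mathcomp Require Import all_boot all_order all_algebra.
From mathcomp Require Import all_classical all_reals all_analysis.
From mathcomp Require Import finmap ring lra zify.
From mathcomp.multinomials Require Import -(notations) monalg.

Set Implicit Arguments.
Unset Strict Implicit.
Unset Printing Implicit Defensive.

Import Order.TTheory GRing.Theory Num.Theory.
Import numFieldNormedType.Exports.
Local Open Scope classical_set_scope.
Local Open Scope ring_scope.
Local Open Scope quotient_scope.

(** Let [mu ^+ 2] be the least height of a nonzero class of the Mordell-Weil group,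
so that [mu] is the least length of a nonzero vector of the lattice. Everything
rests on the fact that this minimum exists and is positive, and more generally
that only finitely many classes have height below a given bound.

That fact comes from the theory of the canonical height. The naive height of a
point is the height of its x-coordinate. Since [x(2P)] is a rational function of
degree 4 of [x(P)], and the symmetric functions of [x(P + Q)] and [x(P - Q)] are
biquadratic in [x(P)] and [x(Q)], the naive height satisfies the parallelogram law
up to a bounded error. For sums and differences an upper bound suffices
([add_sub_height]); the lower bound is that for duplication ([double_height]),
where explicit Bezout relations provide it. Tate's limit then turns the naive
height into an exact quadratic function at bounded distance from it
([tate_limit_parallelogram], [tate_limit_close]), so Northcott's finiteness
theorem carries over ([finite_height]), and a class of height zero is zero
([height_eq0]).

The height pairing is biadditive, so its real extension is a symmetric bilinear
form, nonnegative by rational approximation ([bilinear_extension_ge0]). Its square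
root satisfies the triangle inequality, and it is at least [mu] on the nonzero
vectors of the lattice.

For the successive minima, independence of lattice vectors over the reals is the
same as independence of the classes over the integers
([lin_independent_realify]), and by finiteness of bounded sets of heights all the
infima are attained ([minimum_radii_least]).

For the systole, a closed curve of length less than [mu] stays in a ball of radius
less than [mu / 2], which lifts to [V] and is contracted there radially
([noncontractible_length_ge]). Conversely the geodesic loop of a shortest nonzero
lattice vector [v] has length at most [mu] and is not contractible: summing short
lifts of the steps of a fine grid gives a winding vector, which a homotopy
preserves and which is [v] for the loop and 0 for a constant curve
([geodesic_noncontractible]). *)

(** * The x-coordinates of 2P, P + Q and P - Q *)

Section Addition.
Variable E : elliptic_curve.
Local Notation a1 := (a1 E).
Local Notation a2 := (a2 E).
Local Notation a3 := (a3 E).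
Local Notation a4 := (a4 E).
Local Notation a6 := (a6 E).

(** The usual invariants of a Weierstrass equation: the duplication formula and
the formulas for [x(P + Q)] and [x(P - Q)] involve only these. *)
Definition b2 := a1 ^+ 2 + 4 * a2.
Definition b4 := 2 * a4 + a1 * a3.
Definition b6 := a3 ^+ 2 + 4 * a6.
Definition b8 := a1 ^+ 2 * a6 + 4 * a2 * a6 - a1 * a3 * a4 + a2 * a3 ^+ 2
                - a4 ^+ 2.
Definition disc := - b2 ^+ 2 * b8 - 8 * b4 ^+ 3 - 27 * b6 ^+ 2 + 9 * b2 * b4 * b6.

Lemma disc_neq0 : disc != 0. Proof. by rewrite /disc /b8 /b6 /b4 /b2; case: E. Qed.

Lemma b8E : b8 = (b2 * b6 - b4 ^+ 2) / 4.
Proof. by rewrite /b8 /b6 /b4 /b2; field. Qed.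

(** [x(2P)] is a quotient of a quartic by a cubic; the cubic is
[(2 y + a1 x + a3) ^+ 2], which vanishes exactly when [2P] is at infinity. *)
Lemma double_affine x y : on_curve E (Some (x, y)) ->
  (if add_coords E (Some (x, y)) (Some (x, y)) is Some (x', _) then
    (4 * x ^+ 3 + b2 * x ^+ 2 + 2 * b4 * x + b6) * x' =
     x ^+ 4 - b4 * x ^+ 2 - 2 * b6 * x - b8
  else 4 * x ^+ 3 + b2 * x ^+ 2 + 2 * b4 * x + b6 = 0).
Proof.
move=> /eqP e.
have e6 : a6 = y ^+ 2 + a1 * x * y + a3 * y - x ^+ 3 - a2 * x ^+ 2 - a4 * x.
  by rewrite e; ring.
rewrite /= eqxx /= /b8 /b6 /b4 /b2 e6.
case: eqP => [z|/eqP n].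
  have ->: a3 = - (y + y + a1 * x) by apply/eqP; rewrite -addr_eq0 addrC z.
  by ring.
have d : 2 * y + a1 * x + a3 != 0 by move: n; congr (_ != 0); ring.
by field.
Qed.

(** Replacing [P] or [Q] by its opposite preserves the pair [x(P + Q)], [x(P - Q)] up to
order, so its symmetric functions depend on [x(P)] and [x(Q)] alone. *)
Lemma add_sub_affine x1 y1 x2 y2 : x1 != x2 ->
  on_curve E (Some (x1, y1)) -> on_curve E (Some (x2, y2)) ->
  exists x3 y3 x4 y4,
  [/\ add_coords E (Some (x1, y1)) (Some (x2, y2)) = Some (x3, y3),
   add_coords E (Some (x1, y1)) (opp_coords E (Some (x2, y2))) = Some (x4, y4),
   (x1 - x2) ^+ 2 * (x3 + x4) =
     2 * x1 * x2 * (x1 + x2) + b2 * x1 * x2 + b4 * (x1 + x2) + b6 &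
   (x1 - x2) ^+ 2 * (x3 * x4) =
     (x1 * x2) ^+ 2 - b4 * x1 * x2 - b6 * (x1 + x2) - b8].
Proof.
move=> n12 /eqP e1 /eqP e2; rewrite /= (negbTE n12) /=.
have d12 : x2 - x1 != 0 by rewrite subr_eq0 eq_sym.
(* The two curve equations are linear in a4 and a6: solving them turns both
   identities into identities of rational functions in free variables. *)
have E6 : a6 = y1 ^+ 2 + a1 * x1 * y1 + a3 * y1 - x1 ^+ 3 - a2 * x1 ^+ 2
    - a4 * x1 by rewrite e1; ring.
have E4 : a4 = (y2 ^+ 2 + a1 * x2 * y2 + a3 * y2 - x2 ^+ 3 - a2 * x2 ^+ 2
    - (y1 ^+ 2 + a1 * x1 * y1 + a3 * y1 - x1 ^+ 3 - a2 * x1 ^+ 2)) / (x2 - x1).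
  by rewrite e1 e2; field.
do 4!eexists; split; [by []|by []| |];
  by rewrite /b8 /b6 /b4 /b2 E6 E4; field.
Qed.

End Addition.

(** * Heights on the projective line and growth of forms *)

Definition proj_height (t : int * int) : nat := maxn `|t.1|%N `|t.2|%N.

(** Sending the point at infinity to [1 : 0] gives it height 1, and makes the
duplication formula in homogeneous form valid there too. *)
Definition x_coord (P : option (rat * rat)) : int * int :=
  if P is Some (x, _) then (numq x, denq x) else (1, 0).

Lemma x_coord_coprime P : coprimez (x_coord P).1 (x_coord P).2.
Proof. by case: P => [[x y]|] //; exact: coprime_num_den. Qed.

(** Evaluated at integers, a form with rational coefficients has bounded
denominators and grows like the weight [w] of its degree: all that a height
estimate has to know about it, for arbitrary rational coefficients. *)
Definition tame (T : Type) (w f : T -> rat) : Prop :=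
  exists N K : nat, (0 < N)%N /\
    forall t, (exists z : int, N%:R * f t = z%:~R) /\ `|f t| <= K%:R * w t.

Lemma tameC (T : Type) (c : rat) : tame (fun _ : T => 1) (fun=> c).
Proof.
exists `|denq c|%N, (Num.Def.archi_bound `|c|); split.
  by rewrite absz_gt0 denq_neq0.
move=> _; split; last by rewrite mulr1 ltW // archi_boundP.
exists (numq c); rewrite numqE mulrC; congr (_ * _).
by rewrite -[in RHS](gez0_abs (ltW (denq_gt0 c))).
Qed.

Lemma tameD T (w f g : T -> rat) : tame w f -> tame w g ->
  tame w (fun t => f t + g t).
Proof.
move=> [N [K [N0 h]]] [N' [K' [N0' h']]]; exists (N * N')%N, (K + K')%N.
split=> [|t]; first by rewrite muln_gt0 N0.
have [[z e] b] := h t; have [[z' e'] b'] := h' t; split.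
  exists (z * N'%:Z + N%:Z * z'); rewrite intrD !intrM -e -e' natrM.
  by rewrite -!pmulrn; ring.
by rewrite natrD mulrDl (le_trans (ler_normD _ _)) // lerD.
Qed.

Lemma tameM T (w w' f g : T -> rat) : tame w f -> tame w' g ->
  tame (fun t => w t * w' t) (fun t => f t * g t).
Proof.
move=> [N [K [N0 h]]] [N' [K' [N0' h']]]; exists (N * N')%N, (K * K')%N.
split=> [|t]; first by rewrite muln_gt0 N0.
have [[z e] b] := h t; have [[z' e'] b'] := h' t; split.
  by exists (z * z'); rewrite intrM -e -e' natrM; ring.
by rewrite natrM mulrACA normrM ler_pM.
Qed.

Lemma tame_ext T (w w' f f' : T -> rat) :
  w =1 w' -> f =1 f' -> tame w f -> tame w' f'.
Proof. by move=> /funext -> /funext ->. Qed.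

Lemma tame_monomial (T : Type) (s : T -> int * int) (c : rat) (i j : nat) :
  tame (fun t => (proj_height (s t))%:R ^+ (i + j))
       (fun t => c * (s t).1%:~R ^+ i * (s t).2%:~R ^+ j).
Proof.
have tameX (f : T -> rat) k : tame (fun t => (proj_height (s t))%:R) f ->
    tame (fun t => (proj_height (s t))%:R ^+ k) (fun t => f t ^+ k).
  move=> h; elim: k => [|k IH]; first exact: tameC.
  by apply: tame_ext (tameM h IH) => t /=; rewrite exprS.
have := tameM (tameM (tameC T c) (tameX (fun t => (s t).1%:~R) i _))
  (tameX (fun t => (s t).2%:~R) j _).
move=> h; apply: tame_ext (h _ _) => // [t||].
- by rewrite mul1r exprD.
- exists 1%N, 1%N; split=> // t; split; first by exists (s t).1; rewrite mul1r.
  by rewrite mul1r -intr_norm -abszE -pmulrn ler_nat leq_maxl.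
- exists 1%N, 1%N; split=> // t; split; first by exists (s t).2; rewrite mul1r.
  by rewrite mul1r -intr_norm -abszE -pmulrn ler_nat leq_maxr.
Qed.

(** Forms that are compared through their ratio must be made integral by the same
factor. *)
Lemma tame_seq T (w : T -> rat) (fs : seq (T -> rat)) :
  (forall t, 0 <= w t) ->
  foldr (fun f => and (tame w f)) True fs ->
  exists N K : nat, (0 < N)%N /\ forall t,
    foldr (fun f => and ((exists z : int, N%:R * f t = z%:~R) /\
                         `|f t| <= K%:R * w t)) True fs.
Proof.
move=> w0; elim: fs => [|f fs IH] /=; first by exists 1%N, 0%N.
move=> [[N [K [N0 h]]] /IH [N' [K' [N0' h']]]].
exists (N * N')%N, (K + K')%N; split=> [|t]; first by rewrite muln_gt0 N0.
have [[z e] b] := h t; split.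
  split; first by exists (z * N'%:Z); rewrite intrM -e natrM -!pmulrn; ring.
  by rewrite (le_trans b) // natrD mulrDl lerDl mulr_ge0.
move: (h' t) => {IH h'}; elim: fs => [|f' fs IH] //= [[[z' e'] b'] /IH ?]; split=> //.
split; first by exists (N%:Z * z'); rewrite intrM -e' natrM -!pmulrn; ring.
by rewrite (le_trans b') // natrD mulrDl lerDr mulr_ge0.
Qed.

(** * The height of 2P *)

Lemma proj_height_gt0 s : coprimez s.1 s.2 -> (0 < proj_height s)%N.
Proof.
case: s => m n /=; rewrite /proj_height /=; apply: contraTltn.
by rewrite leqn0 -leqn0 geq_max !leqn0 !absz_eq0 => /andP[/eqP-> /eqP->].
Qed.

Lemma proj_heightE (s : int * int) :
  (proj_height s)%:R = `|s.1%:~R| :> rat \/ (proj_height s)%:R = `|s.2%:~R| :> rat.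
Proof.
by rewrite /proj_height /maxn -!intr_norm -!abszE -!pmulrn; case: ifP; [right|left].
Qed.

Lemma proj_height_le (s : int * int) (C : rat) :
  `|s.1%:~R| <= C -> `|s.2%:~R| <= C -> (proj_height s)%:R <= C.
Proof. by case: (proj_heightE s) => ->. Qed.

Lemma intr_eq_mul (a b c d : int) :
  a%:~R * b%:~R = c%:~R * d%:~R :> rat -> a * b = c * d.
Proof. by rewrite -!intrM => /intr_inj. Qed.

(** With a Bezout relation [u m + v n = 1] for the primitive pair, the factor is
[u a + v b]. *)
Lemma proportional_int (s : int * int) (a b : int) : coprimez s.1 s.2 ->
  a * s.2 = b * s.1 -> exists k : int, a = k * s.1 /\ b = k * s.2.
Proof.
move=> /coprimezP[[u v] /= e] h; exists (u * a + v * b); split.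
  have -> : (u * a + v * b) * s.1 = u * s.1 * a + v * (b * s.1) by ring.
  by rewrite -h -[LHS]mul1r -e; ring.
have -> : (u * a + v * b) * s.2 = u * (a * s.2) + v * s.2 * b by ring.
by rewrite h -[LHS]mul1r -e; ring.
Qed.

Definition cubic_form (c3 c2 c1 c0 : rat) (t : int * int) : rat :=
  let m := t.1%:~R in let n := t.2%:~R in
  c3 * m ^+ 3 + c2 * m ^+ 2 * n + c1 * m * n ^+ 2 + c0 * n ^+ 3.

Definition quartic_form (c4 c3 c2 c1 c0 : rat) (t : int * int) : rat :=
  let m := t.1%:~R in let n := t.2%:~R in
  c4 * m ^+ 4 + c3 * m ^+ 3 * n + c2 * m ^+ 2 * n ^+ 2 + c1 * m * n ^+ 3
  + c0 * n ^+ 4.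

Lemma tame_cubic c3 c2 c1 c0 :
  tame (fun t => (proj_height t)%:R ^+ 3) (cubic_form c3 c2 c1 c0).
Proof.
apply: tame_ext (tameD (tameD (tameD (tame_monomial id c3 3 0)
  (tame_monomial id c2 2 1)) (tame_monomial id c1 1 2))
  (tame_monomial id c0 0 3)) => // t /=.
by rewrite /cubic_form; ring.
Qed.

Lemma tame_quartic c4 c3 c2 c1 c0 :
  tame (fun t => (proj_height t)%:R ^+ 4) (quartic_form c4 c3 c2 c1 c0).
Proof.
apply: tame_ext (tameD (tameD (tameD (tameD (tame_monomial id c4 4 0)
  (tame_monomial id c3 3 1)) (tame_monomial id c2 2 2))
  (tame_monomial id c1 1 3)) (tame_monomial id c0 0 4)) => // t /=.
by rewrite /quartic_form; ring.
Qed.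

Section Duplication.
Variable E : elliptic_curve.
Local Notation b2 := (b2 E).
Local Notation b4 := (b4 E).
Local Notation b6 := (b6 E).
Local Notation b8 := (b8 E).
Local Notation disc := (disc E).

(** Numerator and denominator of the duplication formula, made homogeneous. *)
Definition double_num := quartic_form 1 0 (- b4) (- 2 * b6) (- b8).
Definition double_den := quartic_form 0 4 b2 (2 * b4) b6.

(** Cofactors of a Bezout relation between numerator and denominator of the
duplication map: since the curve is smooth these have no common factor, and the
ideal they span contains [disc * n ^+ 7] and [disc * m ^+ 7]. The coefficients
solve the resulting linear systems. *)
Definition bezout_n7_num :=
  cubic_form 0 (- 48) (- 8 * b2) (b2 ^+ 2 - 32 * b4).
Definition bezout_n7_den :=
  cubic_form 12 (- b2) (- 10 * b4) (b2 * b4 - 27 * b6).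
Definition bezout_m7_num := cubic_form
  (b2 ^+ 2 * b4 ^+ 2 / 4 - 8 * b4 ^+ 3 - b2 ^+ 3 * b6 / 4 + 9 * b2 * b4 * b6
   - 27 * b6 ^+ 2)
  (- b2 * b4 ^+ 3 + b2 ^+ 2 * b4 * b6 + b4 ^+ 2 * b6 - 5 * b2 * b6 ^+ 2)
  (- 3 * b4 ^+ 4 + 13 / 4 * b2 * b4 ^+ 2 * b6 - b2 ^+ 2 * b6 ^+ 2 / 4
   - 11 * b4 * b6 ^+ 2)
  (- 3 / 2 * b4 ^+ 3 * b6 + 3 / 2 * b2 * b4 * b6 ^+ 2 - 6 * b6 ^+ 3).
Definition bezout_m7_den := cubic_form
  (b2 * b4 ^+ 3 / 4 - b2 ^+ 2 * b4 * b6 / 4 - b4 ^+ 2 * b6 / 4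
   + 5 / 4 * b2 * b6 ^+ 2)
  (- 5 / 4 * b4 ^+ 4 + 3 / 2 * b2 * b4 ^+ 2 * b6 - b2 ^+ 2 * b6 ^+ 2 / 4
   - 4 * b4 * b6 ^+ 2)
  (- b2 * b4 ^+ 4 / 16 + b2 ^+ 2 * b4 ^+ 2 * b6 / 8 - 13 / 4 * b4 ^+ 3 * b6
   - b2 ^+ 3 * b6 ^+ 2 / 16 + 13 / 4 * b2 * b4 * b6 ^+ 2 - 12 * b6 ^+ 3)
  (3 / 8 * b4 ^+ 5 - 3 / 4 * b2 * b4 ^+ 3 * b6 + 3 / 8 * b2 ^+ 2 * b4 * b6 ^+ 2
   + 3 / 2 * b4 ^+ 2 * b6 ^+ 2 - 3 / 2 * b2 * b6 ^+ 3).

Lemma bezout_n7 t :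
  bezout_n7_num t * double_num t + bezout_n7_den t * double_den t
  = disc * t.2%:~R ^+ 7.
Proof.
rewrite /bezout_n7_num /bezout_n7_den /double_num /double_den.
by rewrite /cubic_form /quartic_form /disc b8E; field.
Qed.

Lemma bezout_m7 t :
  bezout_m7_num t * double_num t + bezout_m7_den t * double_den t
  = disc * t.1%:~R ^+ 7.
Proof.
rewrite /bezout_m7_num /bezout_m7_den /double_num /double_den.
by rewrite /cubic_form /quartic_form /disc b8E; field.
Qed.

Lemma double_proportional P : on_curve E P ->
  double_num (x_coord P) * (x_coord (add_coords E P P)).2%:~R =
  double_den (x_coord P) * (x_coord (add_coords E P P)).1%:~R.
Proof.
case: P => [[x y]|] oP; last first.
  by rewrite /double_num /double_den /quartic_form /=; ring.
have := double_affine oP.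
case: (add_coords E _ _) => [[x' y']|];
  rewrite /double_num /double_den /quartic_form /=.
  rewrite !numqE; set n := (denq x)%:~R; set n' := (denq x')%:~R => e.
  transitivity (n ^+ 4 * n' *
    (x ^+ 4 - b4 * x ^+ 2 - 2 * b6 * x - b8)); first by ring.
  by rewrite -e; ring.
rewrite numqE mulr0 mulr1; set n := (denq x)%:~R => e.
transitivity (n ^+ 4 * (4 * x ^+ 3 + b2 * x ^+ 2 + 2 * b4 * x + b6)).
  by rewrite e mulr0.
by ring.
Qed.

(** Duplication has degree 4 on x-coordinates, so it raises heights to the fourth
power up to a bounded factor. For the lower bound, the Bezout relations say
both that the two values of the duplication forms cannot cancel much, as their
common factor divides a multiple of the discriminant, and that they cannot
both be small. *)
Lemma double_height : exists K : nat, forall P, on_curve E P ->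
  (proj_height (x_coord P) ^ 4 <= K * proj_height (x_coord (add_coords E P P)))%N /\
  (proj_height (x_coord (add_coords E P P)) <= K * proj_height (x_coord P) ^ 4)%N.
Proof.
have w0 d (t : int * int) : 0 <= (proj_height t)%:R ^+ d :> rat by rewrite exprn_ge0.
have [|N [K [N0 hFG]]] := @tame_seq _ _ [:: double_num; double_den] (w0 4%N).
  by split; [|split=> //]; apply: tame_quartic.
have [|N' [K' [N0' hfg]]] := @tame_seq _ _
    [:: bezout_n7_num; bezout_n7_den; bezout_m7_num; bezout_m7_den] (w0 3%N).
  by do 4?[split; first exact: tame_cubic].
have D0 := disc_neq0 E.
pose Z := N%:Z * N'%:Z * numq disc.
have ZE : Z%:~R = N%:R * N'%:R * disc * (denq disc)%:~R :> rat.
  by rewrite /Z !intrM numqE -!pmulrn; ring.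
pose C := 2 * K'%:R * `|Z|%:~R / (N%:R * `|disc|) : rat.
(* [C] serves the lower bound for the height of [2P], and [N * K] the upper one. *)
exists (Num.Def.archi_bound C + N * K)%N => P oP.
set s := x_coord P; set s' := x_coord _.
have co : coprimez s.1 s.2 by apply: x_coord_coprime.
have co' : coprimez s'.1 s'.2 by apply: x_coord_coprime.
have [[[a ea] bF] [[[b eb] bG] _]] := hFG s.
have [[[f1 ef1] bf1] [[[g1 eg1] bg1] [[[f2 ef2] bf2] [[[g2 eg2] bg2] _]]]] := hfg s.
have [k [ka kb]] : exists k, a = k * s'.1 /\ b = k * s'.2.
  apply: (proportional_int co'); apply: intr_eq_mul.
  by rewrite -ea -eb -!mulrA; congr (_ * _); apply: double_proportional.
(* What a Bezout relation [phi * num + gam * den = disc * x ^+ 7] yields: the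
   common factor [k] divides [Z * x ^+ 7], and [x] is bounded by [k] and the
   height of [2P]. *)
have step (phi gam : rat) (f g x : int) : N'%:R * phi = f%:~R ->
    N'%:R * gam = g%:~R -> `|phi| <= K'%:R * (proj_height s)%:R ^+ 3 ->
    `|gam| <= K'%:R * (proj_height s)%:R ^+ 3 ->
    phi * double_num s + gam * double_den s = disc * x%:~R ^+ 7 ->
    (exists q, Z * x ^+ 7 = k * q) /\
    N%:R * `|disc| * `|x%:~R| ^+ 7 <=
      2 * K'%:R * (proj_height s)%:R ^+ 3 * (`|k|%:~R * (proj_height s')%:R).
  move=> ef eg bf bg e; split.
    exists ((f * s'.1 + g * s'.2) * denq disc); apply: (@intr_inj rat).
    rewrite intrM ZE rmorphXn /=.
    transitivity ((N'%:R * phi * (N%:R * double_num s)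
      + N'%:R * gam * (N%:R * double_den s)) * (denq disc)%:~R).
      transitivity (N%:R * N'%:R * (disc * x%:~R ^+ 7) * (denq disc)%:~R).
        by ring.
      by rewrite -e; ring.
    by rewrite ef eg ea eb ka kb !(intrM, intrD); ring.
  rewrite -mulrA -normrX -normrM -e.
  rewrite -{1}[N%:R]ger0_norm // -normrM.
  have -> : N%:R * (phi * double_num s + gam * double_den s) =
            phi * (N%:R * double_num s) + gam * (N%:R * double_den s) by ring.
  rewrite (le_trans (ler_normD _ _)) // (normrM phi) (normrM gam).
  have bk (y : int) : (`|y|%N <= proj_height s')%N ->
      `|(k * y)%:~R| <= `|k|%:~R * (proj_height s')%:R :> rat.
    move=> h; rewrite intrM normrM intr_norm ler_wpM2l //.
    by rewrite -intr_norm -abszE -pmulrn ler_nat.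
  set B := `|k|%:~R * _; have -> : 2 * K'%:R * (proj_height s)%:R ^+ 3 * B =
    K'%:R * (proj_height s)%:R ^+ 3 * B + K'%:R * (proj_height s)%:R ^+ 3 * B by ring.
  by rewrite ea eb ka kb lerD // ler_pM // bk // (leq_maxl, leq_maxr).
have [[q1 d1] h1] := step _ _ _ _ _ ef1 eg1 bf1 bg1 (bezout_n7 s).
have [[q2 d2] h2] := step _ _ _ _ _ ef2 eg2 bf2 bg2 (bezout_m7 s).
have Z0 : Z != 0.
  by rewrite !mulf_neq0 // ?numq_eq0 // -?lt0n; case: (N) N0; case: (N') N0'.
have dkZ : (k %| Z)%Z.
  have /coprimezP[[u v] /= e] := coprimezXl 7 (coprimezXr 7 co).
  apply/dvdzP; exists (u * q2 + v * q1).
  rewrite -[LHS]mul1r -e mulrDl.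
  have -> : u * s.1 ^+ 7 * Z = u * (Z * s.1 ^+ 7) by ring.
  have -> : v * s.2 ^+ 7 * Z = v * (Z * s.2 ^+ 7) by ring.
  by rewrite d1 d2; ring.
have kZ : (`|k| <= `|Z|)%N by rewrite dvdn_leq // absz_gt0.
have k1 : 1 <= `|k%:~R| :> rat.
  rewrite -intr_norm ler1z -gtz0_ge1 normr_gt0.
  by apply: contraNneq Z0 => k0; rewrite k0 dvd0z in dkZ.
have w4 : 0 <= N%:R * (K%:R * (proj_height s)%:R ^+ 4) :> rat.
  by rewrite mulr_ge0 // mulr_ge0 // exprn_ge0.
split; last first.
  suff h : (proj_height s')%:R <= (N * K)%:R * (proj_height s)%:R ^+ 4 :> rat.
    rewrite -(ler_nat rat) natrM natrX (le_trans h) // ler_wpM2r ?exprn_ge0 //.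
    by rewrite ler_nat leq_addl.
  rewrite natrM -mulrA; apply: proj_height_le.
    apply: (@le_trans _ _ `|a%:~R|).
      by rewrite ka intrM normrM ler_peMl.
    by rewrite -ea normrM ger0_norm // ler_wpM2l.
  apply: (@le_trans _ _ `|b%:~R|).
    by rewrite kb intrM normrM ler_peMl.
  by rewrite -eb normrM ger0_norm // ler_wpM2l.
have M0 : 0 < (proj_height s)%:R :> rat by rewrite ltr0n proj_height_gt0.
have h7 : N%:R * `|disc| * (proj_height s)%:R ^+ 7 <=
      2 * K'%:R * (proj_height s)%:R ^+ 3 * (`|k|%:~R * (proj_height s')%:R).
  by have [{1}->|{1}->] := proj_heightE s.
have N0r : 0 < N%:R * `|disc| by rewrite mulr_gt0 ?ltr0n // normr_gt0.
suff h4 : (proj_height s)%:R ^+ 4 <= C * (proj_height s')%:R.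
  rewrite -(ler_nat rat) natrX natrM (le_trans h4) // ler_wpM2r //.
  rewrite natrD ler_wpDr // ltW // archi_boundP // /C divr_ge0 // ?mulr_ge0 // ltW.
rewrite /C mulrAC ler_pdivlMr // -(ler_pM2r (exprn_gt0 3 M0)).
have -> : (proj_height s)%:R ^+ 4 * (N%:R * `|disc|) * (proj_height s)%:R ^+ 3
   = N%:R * `|disc| * (proj_height s)%:R ^+ 7 by ring.
apply: le_trans h7 _.
have -> : 2 * K'%:R * `|Z|%:~R * (proj_height s')%:R * (proj_height s)%:R ^+ 3
   = 2 * K'%:R * (proj_height s)%:R ^+ 3
     * (`|Z|%:~R * (proj_height s')%:R) :> rat by ring.
by rewrite ler_wpM2l ?mulr_ge0 // ?exprn_ge0 // ler_wpM2r // ler_int -!abszE lez_nat.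
Qed.

End Duplication.

(** * The heights of P + Q and P - Q *)

(** Gauss's lemma for the product of the two linear forms with roots [s] and [t]. *)
Lemma primitive_triple (s t : int * int) :
  coprimez s.1 s.2 -> coprimez t.1 t.2 ->
  exists c : int * int * int,
    c.1.1 * (s.2 * t.2) + c.1.2 * (s.1 * t.2 + t.1 * s.2) + c.2 * (s.1 * t.1)
    = 1.
Proof.
case: s t => [m n] [m' n'] /= /coprimezP[[u v] /= e] /coprimezP[[u' v'] /= e'].
set p0 := n * n'; set p1 := m * n' + m' * n; set p2 := m * m'.
pose g := u * v' - v * u'; pose a := m * n'.
pose A := v * v'; pose B := v * u'; pose C := u * u'.
(* Modulo the ideal spanned by [p0, p1, p2], the product of the two Bezout
   relations reads [g * a = 1], whereas [a ^+ 2] belongs to the ideal. *)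
exists (A * (1 + g * a) - g ^+ 2 * p2, B * (1 + g * a) + g ^+ 2 * a,
        C * (1 + g * a)) => /=.
have e1 : A * p0 + B * p1 + C * p2 + g * a = 1.
  by rewrite /A /B /C /g /a /p0 /p1 /p2 -[RHS]mulr1 -{1}e -e'; ring.
have e2 : a * p1 - p0 * p2 = a ^+ 2 by rewrite /a /p0 /p1 /p2; ring.
transitivity ((A * p0 + B * p1 + C * p2) * (1 + g * a)
  + g ^+ 2 * (a * p1 - p0 * p2)).
  by ring.
rewrite e2 -[RHS](expr1n _ 2) -{2}e1.
have -> : A * p0 + B * p1 + C * p2 = 1 - g * a by rewrite -e1; ring.
by ring.
Qed.

(** The coefficients of a product of two linear forms are not much smaller than the
product of the heights of its factors: two numbers whose sum and product are
both small are themselves small. *)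
Lemma proj_height_prod (s t : int * int) (B : rat) :
  `|(s.2 * t.2)%:~R| <= B -> `|(s.1 * t.2 + t.1 * s.2)%:~R| <= B ->
  `|(s.1 * t.1)%:~R| <= B ->
  (proj_height s * proj_height t)%:R <= 2 * B.
Proof.
rewrite !(intrM, intrD); case: s t => [m n] [m' n'] /=.
set x : rat := m%:~R; set y : rat := n%:~R.
set x' : rat := m'%:~R; set y' : rat := n'%:~R.
move=> h0 h1 h2.
have B0 : 0 <= B by apply: le_trans h0.
have mixed (a b : rat) : `|a + b| <= B -> `|a * b| <= B ^+ 2 -> `|a| <= 2 * B.
  move=> hs hp; rewrite leNgt; apply/negP => ha.
  have hb : `|b| > B.
    rewrite ltNge; apply/negP => hb.
    have : `|a| <= B + B.
      by rewrite -[a](addrK b) (le_trans (ler_normB _ _)) // lerD.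
    by rewrite leNgt; case/negP; move: ha; rewrite mulr_natl mulr2n.
  move: hp; rewrite normrM leNgt => /negP; apply.
  apply: (@le_lt_trans _ _ (2 * B * B)); last first.
    by apply: ltr_pM => //; rewrite mulr_ge0.
  by rewrite expr2 -mulrA ler_peMl ?mulr_ge0 // ler1n.
have ab : `|x * y' * (x' * y)| <= B ^+ 2.
  have -> : x * y' * (x' * y) = (x * x') * (y * y') by ring.
  by rewrite normrM expr2 ler_pM.
have k1 : `|x * y'| <= 2 * B by apply: mixed h1 ab.
have k2 : `|x' * y| <= 2 * B.
  by apply: (mixed _ (x * y')); [rewrite addrC|rewrite mulrC].
have le2 (c : rat) : `|c| <= B -> `|c| <= 2 * B.
  by move=> h; rewrite (le_trans h) // ler_peMl // ler1n.
rewrite natrM; case: (proj_heightE (m, n)) => ->;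
  case: (proj_heightE (m', n')) => ->; rewrite -normrM.
- exact: le2.
- exact: k1.
- by rewrite [_ * _]mulrC.
- exact: le2.
Qed.

Section Parallelogram.
Variable E : elliptic_curve.
Local Notation b2 := (b2 E).
Local Notation b4 := (b4 E).
Local Notation b6 := (b6 E).
Local Notation b8 := (b8 E).

Local Notation T := ((int * int) * (int * int))%type.

(** Bihomogeneous of bidegree (2, 2); [cij] is the coefficient of the monomial that
dehomogenizes to [x1 ^+ i * x2 ^+ j]. *)
Definition biquadratic (c22 c21 c12 c20 c02 c11 c10 c01 c00 : rat) (st : T) : rat :=
  let m := st.1.1%:~R in let n := st.1.2%:~R in
  let m' := st.2.1%:~R in let n' := st.2.2%:~R in
  c22 * (m ^+ 2 * m' ^+ 2) + c21 * (m ^+ 2 * (m' * n')) + c12 * (m * n * m' ^+ 2)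
  + c20 * (m ^+ 2 * n' ^+ 2) + c02 * (n ^+ 2 * m' ^+ 2) + c11 * (m * n * (m' * n'))
  + c10 * (m * n * n' ^+ 2) + c01 * (n ^+ 2 * (m' * n')) + c00 * (n ^+ 2 * n' ^+ 2).

Lemma tame_biquadratic c22 c21 c12 c20 c02 c11 c10 c01 c00 :
  tame (fun st : T => (proj_height st.1)%:R ^+ 2 * (proj_height st.2)%:R ^+ 2)
  (biquadratic c22 c21 c12 c20 c02 c11 c10 c01 c00).
Proof.
have mono c i j k l (ij : (i + j = 2)%N) (kl : (k + l = 2)%N) :
  tame (fun st : T => (proj_height st.1)%:R ^+ 2 * (proj_height st.2)%:R ^+ 2)
   (fun st : T => c * (st.1.1%:~R ^+ i * st.1.2%:~R ^+ j *
                  (st.2.1%:~R ^+ k * st.2.2%:~R ^+ l))).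
  have := tameM (tame_monomial (@fst _ _) c i j) (tame_monomial (@snd _ _) 1 k l).
  by rewrite ij kl; apply: tame_ext => // st; ring.
apply: tame_ext (tameD (tameD (tameD (tameD (tameD (tameD (tameD (tameD
  (mono c22 2 0 2 0 _ _)
  (mono c21 2 0 1 1 _ _)) (mono c12 1 1 2 0 _ _)) (mono c20 2 0 0 2 _ _))
  (mono c02 0 2 2 0 _ _)) (mono c11 1 1 1 1 _ _)) (mono c10 1 1 0 2 _ _))
  (mono c01 0 2 1 1 _ _)) (mono c00 0 2 0 2 _ _)) => // st.
by rewrite /biquadratic; ring.
Qed.

(** The quadratic polynomial with roots [x(P + Q)] and [x(P - Q)] has coefficients
proportional to [sum_scale], [- sum_trace] and [sum_norm]. *)
Definition sum_scale := biquadratic 0 0 0 1 1 (- 2) 0 0 0.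
Definition sum_trace := biquadratic 0 2 2 0 0 b2 b4 b4 b6.
Definition sum_norm := biquadratic 1 0 0 0 0 (- b4) (- b6) (- b6) (- b8).

Lemma x_coord_opp P : x_coord (opp_coords E P) = x_coord P.
Proof. by case: P => [[]|]. Qed.

Lemma opp_coordsK P : opp_coords E (opp_coords E P) = P.
Proof. by case: P => [[x y]|] //=; congr (Some (_, _)); ring. Qed.

Lemma add_coords_opp P : add_coords E P (opp_coords E P) = None.
Proof.
by case: P => [[x y]|] //=; rewrite eqxx (_ : _ + a3 E = 0) ?eqxx //; ring.
Qed.

Lemma same_x_coord P Q :
  on_curve E P -> on_curve E Q -> x_coord P = x_coord Q ->
  Q = P \/ Q = opp_coords E P.
Proof.
case: P Q => [[x1 y1]|] [[x2 y2]|] /=.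
- move=> /eqP e1 /eqP e2 [en ed].
  have e : x1 = x2 by rewrite -(divq_num_den x1) en ed divq_num_den.
  subst x2; have : (y2 - y1) * (y2 + y1 + a1 E * x1 + a3 E) = 0.
    transitivity (y2 ^+ 2 + a1 E * x1 * y2 + a3 E * y2 -
      (y1 ^+ 2 + a1 E * x1 * y1 + a3 E * y1)); first by ring.
    by rewrite e1 e2 subrr.
  move=> /eqP; rewrite mulf_eq0 => /orP[].
    by rewrite subr_eq0 => /eqP->; left.
  move=> /eqP e; right; congr (Some (_, _)).
  by rewrite -[LHS](subr0) -e; ring.
- by move=> _ _ [_ /eqP]; rewrite denq_eq0.
- by move=> _ _ [_ /eqP]; rewrite eq_sym denq_eq0.
- by left.
Qed.

(** By Gauss's lemma the product of the heights of [P + Q] and [P - Q] is comparable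
to the height of the triple of symmetric functions of their x-coordinates,
which is given by biquadratic forms in [P] and [Q]. When [Q] is [P] or [- P]
this is the upper bound for duplication. *)
Lemma add_sub_height : exists K : nat, forall P Q,
  on_curve E P -> on_curve E Q ->
  (proj_height (x_coord (add_coords E P Q)) *
   proj_height (x_coord (add_coords E P (opp_coords E Q)))
   <= K * (proj_height (x_coord P) * proj_height (x_coord Q)) ^ 2)%N.
Proof.
have [K1 dup] := double_height E.
have w0 (st : T) :
    0 <= (proj_height st.1)%:R ^+ 2 * (proj_height st.2)%:R ^+ 2 :> rat.
  by rewrite mulr_ge0 ?exprn_ge0.
have [|N [K [N0 h]]] := @tame_seq _ _ [:: sum_scale; sum_trace; sum_norm] w0.
  by do 3?[split; first exact: tame_biquadratic].
exists (2 * (N * K) + K1 + 1)%N => P Q oP oQ.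
have H0 R : (0 < proj_height (x_coord R))%N by apply/proj_height_gt0/x_coord_coprime.
have [eP|P0] := eqVneq P None.
  by rewrite eP /= x_coord_opp mul1n mulnn leq_pmull // addn1.
have [eQ|Q0] := eqVneq Q None.
  have ad0 : add_coords E P None = P by case: (P) => [[]|].
  by rewrite eQ /= ad0 muln1 mulnn leq_pmull // addn1.
have [ex|nx] := eqVneq (x_coord P) (x_coord Q).
  have dup1 : (proj_height (x_coord (add_coords E P P)) <=
     (2 * (N * K) + K1 + 1)
     * (proj_height (x_coord P) * proj_height (x_coord P)) ^ 2)%N.
    rewrite (leq_trans (dup P oP).2) // mulnn -expnM leq_mul2r -addnA.
    by rewrite (leq_trans (leq_addr 1 K1)) ?orbT // leq_addl.
  have [->|->] := same_x_coord oP oQ ex.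
    by rewrite add_coords_opp muln1.
  by rewrite add_coords_opp opp_coordsK x_coord_opp mul1n.
case: P Q oP oQ P0 Q0 nx => [[x1 y1]|] [[x2 y2]|] // oP oQ _ _ nx.
have n12 : x1 != x2 by apply: contraNneq nx => ->.
have [x3 [y3 [x4 [y4 [-> -> e1 e2]]]]] := add_sub_affine n12 oP oQ.
set s := x_coord (Some (x1, y1)); set t := x_coord (Some (x2, y2)).
set s' := x_coord (Some (x3, y3)); set t' := x_coord (Some (x4, y4)).
have [c ec] : exists c : int * int * int,
    c.1.1 * (s'.2 * t'.2) + c.1.2 * (s'.1 * t'.2 + t'.1 * s'.2)
    + c.2 * (s'.1 * t'.1) = 1.
  by apply: primitive_triple; apply: x_coord_coprime.
have [[[a ea] bF] [[[b eb] bG] [[[d ed] bH] _]]] := h (s, t).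
have d0 : (s'.2 * t'.2)%:~R != 0 :> rat.
  by rewrite intr_eq0 mulf_neq0 // denq_neq0.
have r1 : a * (s'.1 * t'.2 + t'.1 * s'.2) = b * (s'.2 * t'.2).
  apply: intr_eq_mul; rewrite -ea -eb -!mulrA; congr (_ * _).
  rewrite !(intrM, intrD) /= !numqE.
  rewrite /sum_scale /sum_trace /biquadratic /= !numqE.
  set n1 := (denq x1)%:~R; set n2 := (denq x2)%:~R.
  set n3 := (denq x3)%:~R; set n4 := (denq x4)%:~R.
  transitivity (n1 ^+ 2 * n2 ^+ 2 * n3 * n4 * ((x1 - x2) ^+ 2 * (x3 + x4))).
    by ring.
  by rewrite e1; ring.
have r2 : a * (s'.1 * t'.1) = d * (s'.2 * t'.2).
  apply: intr_eq_mul; rewrite -ea -ed -!mulrA; congr (_ * _).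
  rewrite !(intrM, intrD) /= !numqE.
  rewrite /sum_scale /sum_norm /biquadratic /= !numqE.
  set n1 := (denq x1)%:~R; set n2 := (denq x2)%:~R.
  set n3 := (denq x3)%:~R; set n4 := (denq x4)%:~R.
  transitivity (n1 ^+ 2 * n2 ^+ 2 * n3 * n4 * ((x1 - x2) ^+ 2 * (x3 * x4))).
    by ring.
  by rewrite e2; ring.
have a0 : a != 0.
  rewrite -(intr_eq0 rat) -ea mulf_neq0 ?pnatr_eq0 -?lt0n //.
  rewrite /sum_scale /biquadratic /= !numqE.
  set n1 := (denq x1)%:~R; set n2 := (denq x2)%:~R.
  rewrite (_ : _ + _ = (n1 * n2 * (x1 - x2)) ^+ 2); last by ring.
  by rewrite expf_neq0 // !mulf_neq0 ?intr_eq0 ?denq_neq0 // subr_eq0.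
move: r1 r2 ec; set p0 := s'.2 * t'.2; set p1 := _ + _; set p2 := s'.1 * t'.1.
(* The integers [a, b, d] are [k] times a primitive triple, and [k != 0], so the
   triple is at most as large as they are. *)
move=> r1 r2 ec; pose k := c.1.1 * a + c.1.2 * b + c.2 * d.
have p00 : p0 != 0 by rewrite -(intr_eq0 rat).
have k0 : a = k * p0.
  rewrite /k !mulrDl -!mulrA -r1 -r2 -[LHS]mulr1 -ec; ring.
have k1 : b = k * p1 by apply: (mulIf p00); rewrite -r1 {1}k0; ring.
have k2 : d = k * p2 by apply: (mulIf p00); rewrite -r2 {1}k0; ring.
have kge1 : 1 <= `|k%:~R| :> rat.
  rewrite -intr_norm ler1z -gtz0_ge1 normr_gt0.
  by apply: contraNneq a0 => kz; rewrite k0 kz mul0r.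
set B := N%:R * (K%:R * ((proj_height s)%:R ^+ 2 * (proj_height t)%:R ^+ 2)) : rat.
have bound (p z : int) (f : rat) : N%:R * f = z%:~R -> z = k * p ->
    `|f| <= K%:R * ((proj_height s)%:R ^+ 2 * (proj_height t)%:R ^+ 2) ->
    `|p%:~R| <= B.
  move=> ef ez bf; apply: (@le_trans _ _ `|z%:~R|).
    by rewrite ez intrM normrM ler_peMl.
  by rewrite -ef normrM ger0_norm // ler_wpM2l.
have hh := proj_height_prod (bound _ _ _ ea k0 bF) (bound _ _ _ eb k1 bG)
  (bound _ _ _ ed k2 bH).
rewrite -(ler_nat rat) (le_trans hh) //.
have -> : 2 * B = (2 * (N * K) * (proj_height s * proj_height t) ^ 2)%:R.
  by rewrite /B !(natrM, natrX) exprMn; ring.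
by rewrite ler_nat leq_mul2r -addnA leq_addr orbT.
Qed.

End Parallelogram.

(** * Quadratic functions and Tate's limit *)

Section QuadraticForm.
Variables (R : realFieldType) (A : zmodType) (q : A -> R).
Hypothesis parallelogram : forall x y, q (x + y) + q (x - y) = 2 * q x + 2 * q y.

Definition polar x y : R := (q (x + y) - q x - q y) / 2.

Lemma quad0 : q 0 = 0.
Proof. by have := parallelogram 0 0; rewrite subr0 addr0; lra. Qed.

Lemma polarC x y : polar x y = polar y x.
Proof. by rewrite /polar [y + x]addrC; lra. Qed.

Lemma polarxx x : polar x x = q x.
Proof.
by have := parallelogram x x; rewrite /polar subrr quad0; lra.
Qed.

(** Jordan and von Neumann: the parallelogram law makes the polar form additive. *)
Lemma polarDr x y z : polar x (y + z) = polar x y + polar x z.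
Proof.
have h1 := parallelogram (x + z) y; have h2 := parallelogram x (z - y).
have h3 := parallelogram (x + y) z; have h4 := parallelogram z y.
have e1 : x + z + y = x + y + z by rewrite addrAC.
have e2 : x - (z - y) = x + y - z by rewrite opprB addrA.
have e3 : x + (z - y) = x + z - y by rewrite addrA.
have e4 : z + y = y + z by rewrite addrC.
rewrite e1 in h1; rewrite e2 e3 in h2; rewrite e4 in h4.
by rewrite /polar addrA; lra.
Qed.

Lemma polarDl x y z : polar (x + y) z = polar x z + polar y z.
Proof. by rewrite polarC polarDr [polar z x]polarC [polar z y]polarC. Qed.

Lemma polar0r x : polar x 0 = 0.
Proof. by rewrite /polar addr0 quad0; lra. Qed.

Lemma polarMnr x y n : polar x (y *+ n) = n%:R * polar x y.
Proof.
elim: n => [|n IH]; first by rewrite polar0r mul0r.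
by rewrite mulrS polarDr IH -add1n natrD mulrDl mul1r.
Qed.

Lemma quadMn x n : q (x *+ n) = n%:R ^+ 2 * q x.
Proof.
by rewrite -polarxx polarMnr polarC polarMnr polarxx mulrA.
Qed.

(** A torsion element lies in the radical of the polar form. *)
Lemma quad_torsion x t n : (0 < n)%N -> t *+ n = 0 -> q (x + t) = q x.
Proof.
move=> n0 tn; have nz : n%:R != 0 :> R by rewrite pnatr_eq0 -lt0n.
have : polar x t = 0.
  by apply: (mulfI nz); rewrite -polarMnr tn polar0r mulr0.
have : q t = 0.
  by apply: (mulfI (expf_neq0 2 nz)); rewrite -quadMn tn quad0 mulr0.
by rewrite /polar; lra.
Qed.
End QuadraticForm.

Section Tate.
Variables (R : realType) (A : zmodType) (h : A -> R) (C : R).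
Hypothesis h_ge0 : forall x, 0 <= h x.
Hypothesis h_add_sub : forall x y, h (x + y) + h (x - y) <= 2 * h x + 2 * h y + C.
Hypothesis h_double : forall x, 4 * h x <= h (x + x) + C.

(** Tate's telescoping: if [h] is quadratic up to a bounded error, then
[4 ^- n * h (2 ^ n x)] is a Cauchy sequence, whose limit differs from [h] by a
bounded amount. *)
Definition tate_seq x : R ^nat := fun n => (4 ^+ n)^-1 * h (x *+ (2 ^ n)%N).
Definition tate_limit x : R := limn (tate_seq x).

Let C_ge0 : 0 <= C.
Proof. by have := h_double 0; have := h_ge0 0; rewrite addr0; lra. Qed.

Let tate_step x n : `|tate_seq x n.+1 - tate_seq x n| <= (4 ^+ n.+1)^-1 * C.
Proof.
rewrite /tate_seq.
have -> : x *+ (2 ^ n.+1)%N = x *+ (2 ^ n) + x *+ (2 ^ n).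
  by rewrite expnS mul2n -addnn mulrnDr.
move: (x *+ (2 ^ n)%N) => y.
have -> : (4 ^+ n.+1)^-1 * h (y + y) - (4 ^+ n)^-1 * h y =
    (4 ^+ n.+1)^-1 * (h (y + y) - 4 * h y) :> R.
  by rewrite exprS; field; rewrite expf_neq0.
rewrite normrM ger0_norm ?invr_ge0 ?exprn_ge0 // ler_wpM2l ?invr_ge0 ?exprn_ge0 //.
have := h_double y; have := h_add_sub y y; have := h_ge0 (y - y).
by rewrite ler_norml; lra.
Qed.

(** A bound for the sum of all increments from the [n]-th on. *)
Let tail n : R := (C / 3) * (4^-1) ^+ n.

Let tail_step n : tail n - tail n.+1 = (4 ^+ n.+1)^-1 * C.
Proof. by rewrite /tail !exprVn exprS; field; rewrite expf_neq0. Qed.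

Let tail_cvg : tail @ \oo --> 0.
Proof.
by apply: cvg_geometric; rewrite ger0_norm ?invr_ge0 // invf_lt1 // ltr1n.
Qed.

Let upper x n := tate_seq x n + tail n.
Let lower x n := tate_seq x n - tail n.

Let upper_nincr x : {homo upper x : n m / (n <= m)%N >-> m <= n}.
Proof.
apply/nonincreasing_seqP => n; rewrite /upper.
by have := tate_step x n; have := tail_step n; rewrite ler_norml; lra.
Qed.

Let lower_ndecr x : {homo lower x : n m / (n <= m)%N >-> n <= m}.
Proof.
apply/nondecreasing_seqP => n; rewrite /lower.
by have := tate_step x n; have := tail_step n; rewrite ler_norml; lra.
Qed.

Let tate_seq_ge0 x n : 0 <= tate_seq x n.
Proof. by rewrite mulr_ge0 // invr_ge0 exprn_ge0. Qed.

Let upper_cvg x : cvgn (upper x).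
Proof.
apply: (nonincreasing_is_cvgn (@upper_nincr x)); exists 0 => _ [n _ <-].
by rewrite addr_ge0 // /tail mulr_ge0 ?exprn_ge0 ?divr_ge0 ?invr_ge0.
Qed.

Let tate_seqE x : tate_seq x = upper x \- tail.
Proof. by apply/funext => n /=; rewrite /upper addrK. Qed.

(** The increments of the sequence are dominated by those of the geometric sequence
[tail], so adding or subtracting [tail] makes it monotone. *)
Lemma tate_seq_cvg x : tate_seq x @ \oo --> tate_limit x.
Proof.
have : cvgn (tate_seq x).
  by rewrite tate_seqE; apply: is_cvgB => //; apply/cvg_ex; exists 0; exact: tail_cvg.
by [].
Qed.

Let upper_lim x : upper x @ \oo --> tate_limit x.
Proof. by rewrite -[tate_limit x]addr0; apply: cvgD tail_cvg; apply: tate_seq_cvg. Qed.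

Let lower_lim x : lower x @ \oo --> tate_limit x.
Proof. by rewrite -[tate_limit x]subr0; apply: cvgB tail_cvg; apply: tate_seq_cvg. Qed.

Lemma tate_limit_close x : h x - C / 3 <= tate_limit x <= h x + C / 3.
Proof.
have e0 : tate_seq x 0 = h x by rewrite /tate_seq expr0 invr1 mul1r.
have t0 : tail 0 = C / 3 by rewrite /tail mulr1.
apply/andP; split.
  have cl : cvgn (lower x) by apply/cvg_ex; exists (tate_limit x).
  rewrite -(cvg_lim (@Rhausdorff R) (@lower_lim x)).
  by have := nondecreasing_cvgn_le (@lower_ndecr x) cl 0; rewrite /lower e0 t0.
rewrite -(cvg_lim (@Rhausdorff R) (@upper_lim x)).
have := nonincreasing_cvgn_ge (@upper_nincr x) (@upper_cvg x) 0.
by rewrite /upper e0 t0.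
Qed.

Lemma tate_limit_ge0 x : 0 <= tate_limit x.
Proof.
by apply: limr_ge; [apply/cvg_ex; exists (tate_limit x); exact: tate_seq_cvg|
  apply: nearW => n; exact: tate_seq_ge0].
Qed.

Let tate_limit_double x : tate_limit (x + x) = 4 * tate_limit x.
Proof.
apply: cvg_lim => //.
have -> : tate_seq (x + x) = (fun n => 4 * tate_seq x n.+1).
  apply/funext => n; rewrite /tate_seq -mulr2n -mulrnA -expnS exprS.
  by field; rewrite expf_neq0.
apply: cvgMr; have := @tate_seq_cvg x; rewrite -cvg_shiftS; exact.
Qed.

Let tate_limit_add_sub x y :
  tate_limit (x + y) + tate_limit (x - y) <= 2 * tate_limit x + 2 * tate_limit y.
Proof.
have hl : tate_seq (x + y) \+ tate_seq (x - y) @ \oo -->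
  tate_limit (x + y) + tate_limit (x - y) by apply: cvgD; apply: tate_seq_cvg.
have hr : (fun n => 2 * tate_seq x n + 2 * tate_seq y n + 3 * tail n) @ \oo -->
    2 * tate_limit x + 2 * tate_limit y + 3 * 0.
  apply: cvgD; last by apply: cvgMr; exact: tail_cvg.
  by apply: cvgD; apply: cvgMr; apply: tate_seq_cvg.
rewrite -[leRHS]addr0 -(mulr0 3).
apply: ler_cvg_to hl hr _; apply: nearW => n /=.
rewrite /tate_seq /tail exprVn mulrnDl mulrnBl.
have := h_add_sub (x *+ (2 ^ n)) (y *+ (2 ^ n)).
have : 0 < (4 ^+ n)^-1 :> R by rewrite invr_gt0 exprn_gt0.
move: (4 ^+ n)^-1 => c c0 /(ler_wpM2l (ltW c0)); lra.
Qed.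

(** In the limit the constant disappears and one inequality survives. Applied to
[x + y] and [x - y], whose sum and difference are [2x] and [2y], it gives the
opposite inequality, because the limit is multiplied by 4 under doubling. *)
Lemma tate_limit_parallelogram x y :
  tate_limit (x + y) + tate_limit (x - y) = 2 * tate_limit x + 2 * tate_limit y.
Proof.
have h1 := tate_limit_add_sub x y; have h2 := tate_limit_add_sub (x + y) (x - y).
have e1 : x + y + (x - y) = x + x by rewrite addrACA subrr addr0.
have e2 : x + y - (x - y) = y + y by rewrite opprB [x + y]addrC addrACA subrr addr0.
rewrite e1 e2 !tate_limit_double in h2; lra.
Qed.
End Tate.

(** * The canonical height on the Mordell-Weil group *)

Section Heights.
Local Notation point := Defs.point.
Variables (R : realType) (E : elliptic_curve).

Definition naive_height (P : point E) : R := weil_height R (omap fst (coords P)).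

Lemma naive_heightE P : naive_height P = ln (proj_height (x_coord (coords P)))%:R.
Proof.
rewrite /naive_height; case: (coords P) => [[x y]|] //=.
by rewrite /proj_height /= ln1.
Qed.

Lemma coords_on (P : point E) : on_curve E (coords P).
Proof. exact: (valP P). Qed.

Lemma proj_height_x_gt0 P : (0 < proj_height (x_coord P))%N.
Proof. exact/proj_height_gt0/x_coord_coprime. Qed.

Lemma naive_height_ge0 P : 0 <= naive_height P.
Proof. by rewrite naive_heightE ln_ge0 // ler1n proj_height_x_gt0. Qed.

(** Taking logarithms, the naive height is quadratic up to a bounded error, as Tate's
limit requires. *)
Lemma naive_height_quasi : exists C : R,
  (forall P Q, naive_height (P + Q) + naive_height (P - Q) <=
     2 * naive_height P + 2 * naive_height Q + C) /\
  (forall P, 4 * naive_height P <= naive_height (P + P) + C).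
Proof.
have [K1 h1] := add_sub_height E; have [K2 h2] := double_height E.
have lnM' (a b : nat) : (0 < a)%N -> (0 < b)%N ->
    ln (a * b)%:R = ln a%:R + ln b%:R :> R.
  by move=> a0 b0; rewrite natrM lnM // posrE ltr0n.
have lnX' (a n : nat) : (0 < a)%N -> ln (a ^ n)%:R = n%:R * ln a%:R :> R.
  by move=> a0; rewrite natrX lnXn ?ltr0n // mulr_natl.
have ln_le (a b : nat) : (0 < a)%N -> (a <= b)%N -> ln a%:R <= ln b%:R :> R.
  by move=> a0 ab; rewrite ler_ln ?posrE ?ltr0n ?ler_nat // (leq_trans a0).
have K0 (K a b : nat) : (0 < a)%N -> (a <= K * b)%N -> (0 < K)%N.
  by case: K => // a0; rewrite mul0n leqNgt a0.
exists (ln (K1 * K2)%:R); split=> [P Q|P]; rewrite !naive_heightE.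
  have := h1 _ _ (coords_on P) (coords_on Q).
  rewrite -[add_coords E _ (opp_coords _ _)]/(coords (P - Q)).
  rewrite -[add_coords _ _ _]/(coords (P + Q)).
  have := proj_height_x_gt0 (coords (P + Q)).
  have := proj_height_x_gt0 (coords (P - Q)).
  have := proj_height_x_gt0 (coords P); have := proj_height_x_gt0 (coords Q).
  set s := proj_height (x_coord (coords (P + Q))).
  set d := proj_height (x_coord (coords (P - Q))).
  set p := proj_height (x_coord (coords P)).
  set q := proj_height (x_coord (coords Q)) => q0 p0 d0 s0 le.
  have sd0 : (0 < s * d)%N by rewrite muln_gt0 s0.
  have pq0 : (0 < p * q)%N by rewrite muln_gt0 p0.
  have K10 := K0 _ _ _ sd0 le.
  have K20 : (0 < K2)%N.
    by apply: K0 (h2 _ (coords_on 0)).1; rewrite expn_gt0 proj_height_x_gt0.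
  have := ln_le _ _ sd0 le.
  rewrite lnM' // lnM' ?expn_gt0 ?pq0 // lnX' // lnM' // lnM' //.
  by have := ln_le 1%N _ isT K20; rewrite ln1; lra.
have := (h2 _ (coords_on P)).1.
rewrite -[add_coords _ _ _]/(coords (P + P)).
have := proj_height_x_gt0 (coords (P + P)); have := proj_height_x_gt0 (coords P).
have K10 : (0 < K1)%N.
  apply: K0 (h1 _ _ (coords_on 0) (coords_on 0)).
  by rewrite muln_gt0 !proj_height_x_gt0.
set d := proj_height (x_coord (coords (P + P))).
set p := proj_height (x_coord (coords P)) => p0 d0 le.
have p40 : (0 < p ^ 4)%N by rewrite expn_gt0 p0.
have K20 := K0 _ _ _ p40 le.
have := ln_le _ _ p40 le; rewrite lnX' // lnM' // lnM' //.
by have := ln_le 1%N _ isT K10; rewrite ln1; lra.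
Qed.

Lemma canonical_heightE : @canonical_height R E = tate_limit naive_height.
Proof. by []. Qed.

Lemma canonical_height_parallelogram (P Q : point E) :
  canonical_height R (P + Q) + canonical_height R (P - Q) =
  2 * canonical_height R P + 2 * canonical_height R Q.
Proof.
have [C [h1 h2]] := naive_height_quasi; rewrite canonical_heightE.
exact: (tate_limit_parallelogram naive_height_ge0 h1 h2).
Qed.

Lemma canonical_height_ge0 (P : point E) : 0 <= canonical_height R P.
Proof.
have [C [h1 h2]] := naive_height_quasi; rewrite canonical_heightE.
exact: (tate_limit_ge0 naive_height_ge0 h1 h2).
Qed.

Lemma finite_proj_height (n : nat) :
  finite_set [set P : point E | (proj_height (x_coord (coords P)) <= n)%N].
Proof.
have fin_x : finite_set [set s : int * int | (proj_height s <= n)%N].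
  apply: (@sub_finite_set _ _
    ([set (i%:Z - n%:Z, j%:Z - n%:Z) | i in `I_(2 * n).+1 & j in `I_(2 * n).+1])).
    move=> [a b]; rewrite /proj_height /= geq_max => /andP[ha hb].
    have shift (z : int) : (`|z|%N <= n)%N ->
        exists2 i : nat, (i < (2 * n).+1)%N & i%:Z - n%:Z = z.
      move=> hz; exists (absz (z + n%:Z)%R); first by lia.
      by lia.
    have [i hi ei] := shift _ ha; have [j hj ej] := shift _ hb.
    by exists i => //; exists j => //; rewrite ei ej.
  by apply: finite_image2; exact: finite_II.
apply: (@sub_finite_set _ _ (\bigcup_(s in [set s | (proj_height s <= n)%N])
   [set P : point E | x_coord (coords P) = s])).
  by move=> P hP; exists (x_coord (coords P)).
apply: bigcup_finite => // s _.
have [[P eP]|no] := pselect (exists P : point E, x_coord (coords P) = s); last first.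
  rewrite (_ : [set _ | _] = set0) //.
  by apply/seteqP; split=> // P eP; case: no; exists P.
apply: (@sub_finite_set _ _ [set P; - P]); last by [].
move=> Q eQ; have [e|e] := same_x_coord (coords_on P) (coords_on Q)
  (etrans eP (esym eQ)).
  by left; apply: val_inj.
by right; apply: val_inj.
Qed.

(** Northcott: points of bounded height have x-coordinates with bounded numerator
and denominator, and each x-coordinate is shared by at most two points. *)
Lemma finite_canonical_height (B : R) :
  finite_set [set P : point E | canonical_height R P <= B].
Proof.
have [C [h1 h2]] := naive_height_quasi.
apply: sub_finite_set (finite_proj_height (Num.truncn (expR (B + C / 3)))).
move=> P /= hP; have := tate_limit_close naive_height_ge0 h1 h2 P.
rewrite -canonical_heightE => /andP[le _].
have : naive_height P <= B + C / 3 by lra.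
rewrite naive_heightE -ler_expR lnK ?posrE ?ltr0n ?proj_height_x_gt0 //.
by rewrite truncn_ge_nat // expR_ge0.
Qed.
End Heights.

Section MordellWeil.
Variables (R : realType) (E : elliptic_curve).
Local Notation point := Defs.point.
Local Notation M := (mordell_weil E).
Local Notation proj := (\pi_(Quotient.quot (@is_torsion E)) : point E -> M).

Lemma projB (P Q : point E) : proj (P - Q) = proj P - proj Q.
Proof. exact: raddfB. Qed.

Lemma proj_eq (P Q : point E) :
  proj P = proj Q -> exists T, is_torsion T /\ P = Q + T.
Proof.
move=> /eqP; rewrite -[_ == _]/(_ == _ %[mod Quotient.quot (@is_torsion E)]).
by rewrite -Quotient.idealrBE => h; exists (P - Q); rewrite subrKC.
Qed.

(** Torsion does not change the canonical height, so the choice of representative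
in the definition of [height] is immaterial. *)
Lemma height_proj (P : point E) : height R (proj P) = canonical_height R P.
Proof.
rewrite /height; have [|T [/asboolP[n n0 Tn] ->]] := @proj_eq (repr (proj P)) P.
  exact: reprK.
exact: (quad_torsion (@canonical_height_parallelogram R E) _ n0 Tn).
Qed.

Lemma proj_surj (P : M) : exists Q : point E, proj Q = P.
Proof. by exists (repr P); exact: reprK. Qed.

Lemma height_parallelogram (P Q : M) :
  height R (P + Q) + height R (P - Q) = 2 * height R P + 2 * height R Q.
Proof.
have [p <-] := proj_surj P; have [q <-] := proj_surj Q.
have projD : proj (p + q) = proj p + proj q by exact: raddfD.
by rewrite -projD -projB !height_proj canonical_height_parallelogram.
Qed.

Lemma height_ge0 (P : M) : 0 <= height R P.
Proof. exact: canonical_height_ge0. Qed.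

Lemma finite_height (B : R) : finite_set [set P : M | height R P <= B].
Proof.
apply: sub_finite_set (finite_image proj (finite_canonical_height E B)).
move=> P hP; have [p e] := proj_surj P; exists p => //=.
by rewrite -height_proj e.
Qed.

Lemma mordell_weil_torsion_free (P : M) n : (0 < n)%N -> P *+ n = 0 -> P = 0.
Proof.
have [p <-] := proj_surj P => n0.
have projMn : proj (p *+ n) = proj p *+ n by exact: raddfMn.
have proj0 : proj 0 = 0 by exact: raddf0.
rewrite -projMn -proj0 => /proj_eq[T []]; rewrite add0r => /asboolP[m m0 Tm] eT.
apply/eqP; rewrite -[_ == _]/(_ == _ %[mod Quotient.quot (@is_torsion E)]).
rewrite -Quotient.idealrBE subr0; apply/asboolP; exists (n * m)%N.
  by rewrite muln_gt0 n0.
by rewrite mulrnA eT.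
Qed.

(** All multiples of a class of height zero have height zero. Were the class nonzero,
they would be infinitely many, as the group is torsion-free. *)
Lemma height_eq0 (P : M) : height R P = 0 -> P = 0.
Proof.
move=> h0; apply/eqP; apply/negPn/negP => nP.
have inj : injective (fun n : nat => P *+ n).
  have wl : forall m n, (m < n)%N -> P *+ m = P *+ n -> False.
    move=> m n mn e; move/eqP: nP; apply.
    apply: (@mordell_weil_torsion_free _ (n - m)).
      by rewrite subn_gt0.
    by rewrite mulrnBr ?(ltnW mn) // e subrr.
  move=> m n e; case: (ltngtP m n) => // h; first by case: (wl _ _ h e).
  by case: (wl _ _ h (esym e)).
apply: infinite_nat.
have := @finite_preimage _ _ _ (fun n : nat => P *+ n) (fun m n _ _ => @inj m n)
  (finite_height 0).
rewrite (_ : _ @^-1` _ = setT) //; apply/seteqP; split=> // n _ /=.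
by rewrite (quadMn height_parallelogram) h0 mulr0.
Qed.

End MordellWeil.

(** * Real extension of forms on an abelian group *)

Section Realification.
Variables (R : realType) (M : zmodType).
Local Notation V := (realification R M).
Implicit Types (c : M -> R) (b : M -> M -> R).

Definition span_eval c (x : malg M R) : R := \sum_(P <- msupp x) mcoeff P x * c P.

Lemma span_evalEw c (x : malg M R) (d : {fset M}) : fsubset (msupp x) d ->
  span_eval c x = \sum_(P <- d) mcoeff P x * c P.
Proof.
move=> xd; apply: big_fset_incl => // P _ /mcoeff_outdom ->; exact: mul0r.
Qed.

Lemma span_eval_linear c : linear_for *%R (span_eval c).
Proof.
move=> a x y /=.
set d := (msupp x `|` msupp y `|` msupp (a *: x + y))%fset.
have hx : fsubset (msupp x) d by rewrite /d -fsetUA fsubsetUl.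
have hy : fsubset (msupp y) d by rewrite /d fsetUAC fsubsetUr.
have hz : fsubset (msupp (a *: x + y)) d by rewrite fsubsetUr.
rewrite (span_evalEw c hx) (span_evalEw c hy) (span_evalEw c hz) mulr_sumr -big_split.
by apply: eq_bigr => P _; rewrite mcoeffD mcoeffZ mulrDl mulrA.
Qed.

HB.instance Definition _ c := GRing.isLinear.Build R (malg M R) R *%R (span_eval c)
  (span_eval_linear c).

Lemma span_eval_gen c P : span_eval c (gen R P) = c P.
Proof. by rewrite /span_eval /gen msuppU oner_eq0 big_seq_fset1 mcoeffUU mul1r. Qed.

(** Meaningful for additive [c], when it is the linear form sending [P (x) a] to
[a * c P]. *)
Definition real_extension c (v : V) : R := span_eval c (repr v).

(** The relations of the tensor product are killed because [c] is additive. *)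
Lemma real_extension_pi c (x : malg M R) : {morph c : P Q / P + Q} ->
  real_extension c (\pi_V x) = span_eval c x.
Proof.
move=> cD; apply/eqP; rewrite -subr_eq0 -linearB.
have : repr (\pi_V x : V) - x \in additivity_relation (R := R) (M := M).
  by rewrite Quotient.idealrBE reprK.
move=> /asboolP[s ->]; rewrite linear_sum big1 // => t _ /=.
by rewrite linearZ !linearB /= !span_eval_gen cD; ring.
Qed.

Lemma real_extensionD c : {morph c : P Q / P + Q} ->
  {morph real_extension c : v w / v + w}.
Proof.
move=> cD v w; rewrite -[v]reprK -[w]reprK.
have piD (x y : malg M R) : \pi_V (x + y) = \pi_V x + \pi_V y by exact: raddfD.
by rewrite -piD !real_extension_pi // linearD.
Qed.

Lemma real_extensionZ c : {morph c : P Q / P + Q} ->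
  forall a v, real_extension c (a *: v) = a * real_extension c v.
Proof. by move=> cD a v; rewrite [LHS]real_extension_pi // linearZ. Qed.

Lemma real_extension_realify c P : {morph c : P Q / P + Q} ->
  real_extension c (realify R P) = c P.
Proof. by move=> cD; rewrite real_extension_pi // span_eval_gen. Qed.

(** Reduces bilinearity to linearity of [real_extension] in each variable. *)
Lemma bilinear_extensionE b v w :
  bilinear_extension b v w = real_extension (fun P => real_extension (b P) w) v.
Proof.
rewrite /bilinear_extension /real_extension /span_eval; apply: eq_bigr => P _.
by rewrite mulr_sumr; apply: eq_bigr => Q _; rewrite mulrA.
Qed.

Section Form.
Variable b : M -> M -> R.
Hypothesis bDl : forall Q, {morph b^~ Q : P P' / P + P'}.
Hypothesis bC : forall P Q, b P Q = b Q P.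
Hypothesis b_ge0 : forall P, 0 <= b P P.
Local Notation B := (bilinear_extension b).

Let bDr P : {morph b P : Q Q' / Q + Q'}.
Proof. by move=> Q Q'; rewrite !(bC P) bDl. Qed.

Let innerD w : {morph (fun P => real_extension (b P) w) : P P' / P + P'}.
Proof.
move=> P P'; rewrite /= /real_extension /span_eval.
by rewrite -big_split; apply: eq_bigr => Q _; rewrite bDl mulrDr.
Qed.

Lemma bilinear_extensionC v w : B v w = B w v.
Proof.
rewrite /bilinear_extension exchange_big; apply: eq_bigr => P _.
by apply: eq_bigr => Q _; rewrite bC [_ * mcoeff P _]mulrC.
Qed.

Lemma bilinear_extensionDl u v w : B (u + v) w = B u w + B v w.
Proof. by rewrite !bilinear_extensionE real_extensionD. Qed.

Lemma bilinear_extensionZl a v w : B (a *: v) w = a * B v w.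
Proof. by rewrite !bilinear_extensionE real_extensionZ. Qed.

Lemma bilinear_extension_realify P Q : B (realify R P) (realify R Q) = b P Q.
Proof. by rewrite bilinear_extensionE !real_extension_realify. Qed.

Let int_form (s : seq M) (f : M -> int) :
  0 <= \sum_(P <- s) \sum_(Q <- s) (f P)%:~R * (f Q)%:~R * b P Q.
Proof.
have bZr P Q (z : int) : b P (Q *~ z) = z%:~R * b P Q.
  pose bP : M -> R := b P.
  have bPB : zmod_morphism bP.
    by move=> x y; apply: (addIr (bP y)); rewrite -bDr !subrK.
  pose h : {additive M -> R} := HB.pack bP (GRing.isZmodMorphism.Build _ _ bP bPB).
  by rewrite -[b P _]/(h _) raddfMz mulrzl.
have b0r P : b P 0 = 0 by apply: (addrI (b P 0)); rewrite -bDr !addr0.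
have sumr P (I : seq M) F : b P (\sum_(Q <- I) F Q) = \sum_(Q <- I) b P (F Q).
  by elim/big_rec2: _ => [|Q x y _ <-]; rewrite ?b0r ?bDr.
have := b_ge0 (\sum_(P <- s) P *~ f P); rewrite sumr; congr (0 <= _).
apply: eq_bigr => P _; rewrite bZr bC sumr mulr_sumr; apply: eq_bigr => Q _.
by rewrite bZr bC mulrA.
Qed.

(** Nonnegativity passes from integral to real combinations by approximation: for
real coefficients [g], round [n * g] down to integers. The form at the rounded
vector is nonnegative and differs from [n ^+ 2 * S g g] by [O(n)]. *)
Lemma bilinear_extension_ge0 v : 0 <= B v v.
Proof.
rewrite /bilinear_extension; set x := repr v; pose s := enum_fset (msupp x).
pose g P := mcoeff P x.
pose S (f f' : M -> R) := \sum_(P <- s) \sum_(Q <- s) f P * f' Q * b P Q.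
rewrite -[leRHS]/(S g g).
pose K := \sum_(P <- s) \sum_(Q <- s) (`|g P| + `|g Q| + 1) * `|b P Q|.
have K0 : 0 <= K.
  by apply: sumr_ge0 => P _; apply: sumr_ge0 => Q _; rewrite mulr_ge0 // !addr_ge0.
have key (n : nat) : - K * n.+1%:R <= S g g * n.+1%:R ^+ 2.
  pose f P : int := Num.floor (n.+1%:R * g P).
  pose e P : R := n.+1%:R * g P - (f P)%:~R.
  have e01 P : 0 <= e P < 1.
    rewrite /e subr_ge0 floor_le_tmp /= ltrBlDl.
    by have := floorD1_gt (n.+1%:R * g P); rewrite intrD addrC.
  have : 0 <= S (fun P => (f P)%:~R) (fun P => (f P)%:~R) by apply: int_form.
  suff : S (fun P => (f P)%:~R) (fun P => (f P)%:~R) <=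
      S g g * n.+1%:R ^+ 2 + K * n.+1%:R.
    by lra.
  rewrite /S /K !mulr_suml -big_split ler_sum // => P _.
  rewrite !mulr_suml -big_split ler_sum // => Q _ /=.
  have -> : (f P)%:~R = n.+1%:R * g P - e P by rewrite /e; ring.
  have -> : (f Q)%:~R = n.+1%:R * g Q - e Q by rewrite /e; ring.
  rewrite -lerBlDl.
  have -> : (n.+1%:R * g P - e P) * (n.+1%:R * g Q - e Q) * b P Q
     - g P * g Q * b P Q * n.+1%:R ^+ 2 =
     (- e Q * (n.+1%:R * g P) - e P * (n.+1%:R * g Q) + e P * e Q) * b P Q by ring.
  apply: le_trans (ler_norm _) _; rewrite normrM mulrAC ler_wpM2r //.
  have N1 : 1 <= n.+1%:R :> R by rewrite ler1n.
  have en P' : `|e P'| <= 1 by have /andP[? /ltW] := e01 P'; rewrite ger0_norm.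
  rewrite [leRHS]mulrDl mul1r; apply: le_trans (ler_normD _ _) _.
  apply: lerD; last first.
    by rewrite normrM (le_trans _ N1) // mulr_ile1.
  rewrite [leRHS]mulrDl; apply: le_trans (ler_normB _ _) _.
  have small (z y : R) : `|z| <= 1 -> `|z * (n.+1%:R * y)| <= `|y| * n.+1%:R.
    move=> hz; rewrite normrM normrM (ger0_norm (ler0n _ _)) [leRHS]mulrC.
    by rewrite ler_piMl ?mulr_ge0.
  by apply: lerD; apply: small; rewrite ?normrN.
rewrite leNgt; apply/negP => neg.
have := key (Num.truncn (K / - S g g)).
set n := _.+1; rewrite expr2 mulrA ler_pM2r ?ltr0n //.
rewrite leNgt => /negP; apply; rewrite -ltrN2 opprK -mulNr.
by rewrite -ltr_pdivrMl ?oppr_gt0 // mulrC truncnS_gt.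
Qed.

End Form.
End Realification.

(** * The height norm, and independence over the integers and the reals *)

Section SemiNorm.
Variables (R : realType) (V : lmodType R) (B : V -> V -> R).
Hypothesis BC : forall v w, B v w = B w v.
Hypothesis BDl : forall u v w, B (u + v) w = B u w + B v w.
Hypothesis BZl : forall a v w, B (a *: v) w = a * B v w.
Hypothesis B_ge0 : forall v, 0 <= B v v.
Local Notation N v := (Num.sqrt (B v v)).

Lemma form_sqrtZ a v : N (a *: v) = `|a| * N v.
Proof. by rewrite BZl BC BZl mulrA -expr2 sqrtrM ?sqr_ge0 // sqrtr_sqr. Qed.

Let expand a v b w :
  B (a *: v + b *: w) (a *: v + b *: w) =
  a ^+ 2 * B v v + 2 * a * b * B v w + b ^+ 2 * B w w.
Proof.
by rewrite BDl !BZl ![B _ (_ + _)]BC !BDl !BZl (BC w v); ring.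
Qed.

(** If [B w w = 0] then [B v w = 0] too: otherwise [B (v + t w) (v + t w)], affine in
[t], would take the value [-1]. *)
Let cauchy_schwarz v w : B v w ^+ 2 <= B v v * B w w.
Proof.
have [w0|wn0] := eqVneq (B w w) 0.
  have [->|n0] := eqVneq (B v w) 0; first by rewrite expr0n /= mulr_ge0.
  have := B_ge0 (1 *: v + (- (B v v + 1) / (2 * B v w)) *: w).
  rewrite expand w0 leNgt => /negP[].
  have -> : 1 ^+ 2 * B v v + 2 * 1 * (- (B v v + 1) / (2 * B v w)) * B v w +
     (- (B v v + 1) / (2 * B v w)) ^+ 2 * 0 = - 1 by field.
  by rewrite ltrN10.
have wp : 0 < B w w by rewrite lt_def wn0 B_ge0.
have := B_ge0 (B w w *: v + (- B v w) *: w); rewrite expand.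
have -> : B w w ^+ 2 * B v v + 2 * B w w * - B v w * B v w + (- B v w) ^+ 2 * B w w
  = B w w * (B v v * B w w - B v w ^+ 2) by ring.
by rewrite pmulr_rge0 // subr_ge0.
Qed.

(** Minkowski's inequality, from that of Cauchy and Schwarz. *)
Lemma form_sqrtD v w : N (v + w) <= N v + N w.
Proof.
rewrite -(@ler_pXn2r _ 2) ?nnegrE ?addr_ge0 ?sqrtr_ge0 // sqrrD !sqr_sqrtr //.
have -> : B (v + w) (v + w) = B v v + 2 * B v w + B w w.
  by have := expand 1 v 1 w; rewrite !scale1r => ->; ring.
rewrite lerD2r lerD2l -[leRHS]mulr_natl ler_wpM2l // -sqrtrM //.
by rewrite (le_trans (ler_norm _)) // -sqrtr_sqr ler_wsqrtr // cauchy_schwarz.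
Qed.
End SemiNorm.

Section HeightNorm.
Variables (R : realType) (E : elliptic_curve).
Local Notation V := (height_space R E).
Local Notation M := (mordell_weil E).
Local Notation pairing := (@height_pairing R E).

Let par := @height_parallelogram R E.
Let pDl Q : {morph pairing^~ Q : P P' / P + P'}.
Proof. by move=> P P'; exact: (polarDl par). Qed.
Let pC P Q : pairing P Q = pairing Q P. Proof. exact: polarC. Qed.
Let pxx P : pairing P P = height R P. Proof. exact: (polarxx par). Qed.
Let p_ge0 P : 0 <= pairing P P. Proof. by rewrite pxx height_ge0. Qed.

Let BC := bilinear_extensionC pC.
Let BD := bilinear_extensionDl pDl.
Let BZ := bilinear_extensionZl pDl.
Let Bge0 := bilinear_extension_ge0 pDl pC p_ge0.

Lemma height_norm_ge0 (v : V) : 0 <= height_norm v. Proof. exact: sqrtr_ge0. Qed.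

Lemma height_normZ a (v : V) : height_norm (a *: v) = `|a| * height_norm v.
Proof. exact: (form_sqrtZ BC BZ). Qed.

Lemma height_normD (v w : V) : height_norm (v + w) <= height_norm v + height_norm w.
Proof. exact: (form_sqrtD BC BD BZ Bge0). Qed.

Lemma height_norm0 : height_norm (0 : V) = 0.
Proof. by rewrite -(scale0r (0 : V)) height_normZ normr0 mul0r. Qed.

Lemma height_normN (v : V) : height_norm (- v) = height_norm v.
Proof. by rewrite -scaleN1r height_normZ normrN1 mul1r. Qed.

Lemma height_normB (v w : V) : height_norm (v - w) <= height_norm v + height_norm w.
Proof. by rewrite (le_trans (height_normD _ _)) // height_normN. Qed.

Lemma height_norm_realify (P : M) :
  height_norm (realify R P : V) = Num.sqrt (height R P).
Proof.
by rewrite /height_norm (bilinear_extension_realify pDl pC) pxx.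
Qed.
End HeightNorm.

Section Independence.
Variables (R : realType) (M : zmodType) (r : nat) (b : 'I_r -> M).
Hypothesis basis : forall P : M, exists! c : {ffun 'I_r -> int},
  P = \sum_(j < r) b j *~ c j.

Let coordE P : {c : {ffun 'I_r -> int} | P = \sum_(j < r) b j *~ c j}.
Proof. by apply: cid; have [c [e _]] := basis P; exists c. Qed.

Let coord P := sval (coordE P).

Let coord_unique P (c : {ffun 'I_r -> int}) :
  P = \sum_(j < r) b j *~ c j -> coord P = c.
Proof.
have [c' [_ u]] := basis P => e; rewrite -(u _ e); apply/esym/u.
exact: (svalP (coordE P)).
Qed.

Let coordD P Q k : coord (P + Q) k = coord P k + coord Q k.
Proof.
have -> : coord (P + Q) = [ffun j => coord P j + coord Q j].
  apply: coord_unique; rewrite {1}(svalP (coordE P)) {1}(svalP (coordE Q)) -big_split.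
  by apply: eq_bigr => j _; rewrite ffunE mulrzDr.
by rewrite ffunE.
Qed.

(** In coordinates, [P] is a matrix of integers. Clearing denominators, independence
over the integers gives independence over the rationals, that is, full row rank,
and the rank does not change under extension of scalars. Coordinates on the
realification are the linear extensions of those on [M]. *)
Lemma lin_independent_realify (i : nat) (P : 'I_i -> M) :
  int_independent P -> lin_independent (fun j => realify R (P j)).
Proof.
move=> indP c c0.
pose A : 'M[rat]_(i, r) := \matrix_(j, k) (coord (P j) k)%:~R.
have freeA : row_free A.
  rewrite -kermx_eq0; apply/rowV0P => v /sub_kermxP vA.
  pose D := \prod_(j < i) denq (v 0 j).
  have D0 : D != 0 by apply/prodf_neq0 => j _; exact: denq_neq0.
  pose z j : int := numq (v 0 j) * \prod_(l < i | l != j) denq (v 0 l).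
  have zE j : (z j)%:~R = D%:~R * v 0 j :> rat.
    have -> : D = denq (v 0 j) * \prod_(l < i | l != j) denq (v 0 l).
      by rewrite /D (bigD1 j).
    by rewrite /z 2!intrM numqE; ring.
  have z0 : forall j, z j = 0.
    apply: indP; transitivity (\sum_(k < r) b k *~ 0); last first.
      by apply: big1 => k _; rewrite mulr0z.
    transitivity (\sum_(j < i) \sum_(k < r) b k *~ (coord (P j) k * z j)).
      apply: eq_bigr => j _; rewrite {1}(svalP (coordE (P j))) mulrz_suml.
      by apply: eq_bigr => k _; rewrite mulrzA.
    rewrite exchange_big; apply: eq_bigr => k _; rewrite -mulrz_sumr; congr (_ *~ _).
    apply: (@intr_inj rat); rewrite -[RHS](mulr0 D%:~R).
    have := congr1 (fun m : 'rV_r => m 0 k) vA; rewrite !mxE => <-.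
    rewrite mulr_sumr rmorph_sum /=; apply: eq_bigr => j _.
    by rewrite intrM zE mxE; ring.
  apply/rowP => j; rewrite mxE; apply: (mulfI (_ : D%:~R != 0)).
    by rewrite intr_eq0.
  by rewrite -zE z0 mulr0.
pose a : 'rV[R]_i := \row_j c j.
suff a0 : a = 0.
  by move=> j; have := congr1 (fun m : 'rV_i => m 0 j) a0; rewrite !mxE.
apply/eqP; rewrite -(mulmx_free_eq0 a (B := map_mx ratr A)) ?row_free_map //.
apply/eqP/rowP => k; rewrite !mxE.
pose ck (Q : M) : R := (coord Q k)%:~R.
have ckD : {morph ck : Q Q' / Q + Q'} by move=> Q Q'; rewrite /ck coordD intrD.
have extB : linear_for *%R (real_extension ck).
  by move=> x u v; rewrite real_extensionD // real_extensionZ.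
pose h : {linear realification R M -> R | *%R} :=
  HB.pack (real_extension ck) (GRing.isLinear.Build _ _ _ _ _ extB).
rewrite -[RHS](linear0 h) -c0 linear_sum; apply: eq_bigr => j _.
rewrite linearZ !mxE; congr (_ * _).
by rewrite ratr_int [RHS]real_extension_realify.
Qed.
End Independence.

Lemma int_independent_realify (R : realType) (M : zmodType) (i : nat) (P : 'I_i -> M) :
  lin_independent (fun j => realify R (P j)) -> int_independent P.
Proof.
move=> indP c c0 j; apply/eqP; rewrite -(intr_eq0 R); apply/eqP.
apply: (indP (fun j => (c j)%:~R)).
rewrite -[RHS](raddf0 (realify R (M := M))) -c0 raddf_sum; apply: eq_bigr => k _.
by rewrite raddfMz scaler_int.
Qed.

(** * Metric and topology of the height torus *)

Lemma contraction_sub (R : pzRingType) (V : lmodType R) (a b c : V) (s t : R) :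
  c + (1 - s) *: a - (c + (1 - t) *: (a - b)) = (t - s) *: a + (1 - t) *: b.
Proof.
rewrite opprD addrACA subrr add0r scalerBr opprB addrCA addrC -scalerBl.
by congr (_ *: _ + _); rewrite opprB addrC subrKA.
Qed.

Section Torus.
Variables (R : realType) (E : elliptic_curve).
Local Notation V := (height_space R E).
Local Notation T := (height_torus R E).
Local Notation M := (mordell_weil E).
Local Notation N := (@height_norm R E).
Local Notation proj := (\pi_(Quotient.quot (@lattice R E)) : V -> T).
Implicit Types (x y z : T) (v w : V).

Lemma torus_projD v w : proj (v + w) = proj v + proj w. Proof. exact: raddfD. Qed.
Lemma torus_projB v w : proj (v - w) = proj v - proj w. Proof. exact: raddfB. Qed.
Lemma torus_proj0 : proj 0 = 0. Proof. exact: raddf0. Qed.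
Lemma torus_projN v : proj (- v) = - proj v. Proof. exact: raddfN. Qed.
Lemma torus_proj_surj x : exists v, proj v = x.
Proof. by exists (repr x); exact: reprK. Qed.

Lemma torus_proj_eq v w : proj v = proj w <-> v - w \in @lattice R E.
Proof.
split=> [/eqP|h]; last apply/eqP.
  by rewrite -[_ == _]/(_ == _ %[mod Quotient.quot (@lattice R E)]) -Quotient.idealrBE.
by rewrite -[_ == _]/(_ == _ %[mod Quotient.quot (@lattice R E)]) -Quotient.idealrBE.
Qed.

(** Both arguments may be translated along the lattice, so the distance is the
quotient seminorm of the difference. *)
Lemma torus_dist_lt x y (e : R) :
  torus_dist x y < e <-> exists2 v, proj v = x - y & N v < e.
Proof.
split=> [|[u eu ue]].
  move/inf_lt => [|_ [v [w [ev ew ->]]] lt].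
    have [v ev] := torus_proj_surj x; have [w ew] := torus_proj_surj y.
    by exists (N (v - w)), v, w.
  by exists (v - w) => //; rewrite torus_projB ev ew.
have [w ew] := torus_proj_surj y.
apply: le_lt_trans ue; apply: ge_inf.
  by exists 0 => _ [? [? [_ _ ->]]]; exact: height_norm_ge0.
by exists (u + w), w; rewrite torus_projD eu ew subrK addrK.
Qed.

Lemma torus_dist_ge0 x y : 0 <= torus_dist x y.
Proof.
by rewrite leNgt; apply/negP => /torus_dist_lt[v _]; rewrite ltNge height_norm_ge0.
Qed.

Lemma torus_dist_proj v w : torus_dist (proj v) (proj w) <= N (v - w).
Proof.
rewrite leNgt; apply/negP => lt.
by have := lt; rewrite ltNge => /negP; apply; apply: ge_inf;
  [exists 0 => _ [? [? [_ _ ->]]]; exact: height_norm_ge0 | exists v, w].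
Qed.

Lemma torus_distxx x : torus_dist x x = 0.
Proof.
apply/eqP; rewrite eq_le torus_dist_ge0 andbT; have [v <-] := torus_proj_surj x.
by rewrite (le_trans (torus_dist_proj _ _)) // subrr height_norm0.
Qed.

Lemma torus_distC_lt x y e : torus_dist x y < e -> torus_dist y x < e.
Proof.
move=> /torus_dist_lt[v ev lt]; apply/torus_dist_lt; exists (- v).
  by rewrite torus_projN ev opprB.
by rewrite height_normN.
Qed.

Lemma torus_dist_triangle_lt x y z d e :
  torus_dist x y < d -> torus_dist y z < e -> torus_dist x z < d + e.
Proof.
move=> /torus_dist_lt[v ev vd] /torus_dist_lt[w ew we]; apply/torus_dist_lt.
exists (v + w); first by rewrite torus_projD ev ew addrA subrK.
by rewrite (le_lt_trans (height_normD _ _)) // ltrD.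
Qed.

Lemma nbhs_torusP x (U : set T) :
  nbhs x U <-> exists2 e : R, 0 < e & forall y, torus_dist x y < e -> U y.
Proof.
split.
  rewrite nbhsE => -[W [oW Wx] WU]; have [e e0 eW] := oW x Wx.
  by exists e => // y /eW /WU.
move=> [e e0 eU]; rewrite nbhsE.
exists [set y | exists2 d : R, 0 < d & forall z, torus_dist y z < d -> U z];
  last first.
  by move=> y [d d0]; apply; rewrite torus_distxx.
split; last by exists e.
move=> y [d d0 dU]; exists (d / 2); first by rewrite divr_gt0.
move=> z yz; exists (d / 2); first by rewrite divr_gt0.
move=> u zu; apply: dU; rewrite [d]splitr.
exact: torus_dist_triangle_lt yz zu.
Qed.

Lemma torus_within_continuousP (X : topologicalType) (A : set X) (f : X -> T) :
  {within A, continuous f} <->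
  forall p, A p -> forall e : R, 0 < e ->
    \forall q \near p, A q -> torus_dist (f p) (f q) < e.
Proof.
rewrite subspace_continuousP; split=> h p Ap.
  move=> e e0; apply: (h p Ap [set y | torus_dist (f p) y < e]).
  by apply/nbhs_torusP; exists e.
move=> U /nbhs_torusP[e e0 eU]; rewrite /= nbhs_filterE.
by apply: filterS (h p Ap e e0) => q dq Aq; apply/eU/dq.
Qed.

Variable mu : R.
Hypothesis mu_gt0 : 0 < mu.
Hypothesis mu_le : forall P : M, P != 0 -> mu <= Num.sqrt (height R P).

Lemma short_unique v w : proj v = proj w -> N v < mu / 2 -> N w < mu / 2 -> v = w.
Proof.
move=> /torus_proj_eq /asboolP[P eP] hv hw.
have [P0|/mu_le] := eqVneq P 0.
  by apply/eqP; rewrite -subr_eq0 eP P0 raddf0.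
rewrite -(height_norm_realify R) -eP leNgt => /negP[].
by rewrite (le_lt_trans (height_normB _ _)) // [mu]splitr ltrD.
Qed.

(** If every nonzero lattice vector has length at least [mu], a point of the torus
has at most one lift of length less than [mu / 2]. *)
Definition short x : V :=
  xget 0 [set v | proj v = x /\ N v < mu / 2].

Lemma short_proj v : N v < mu / 2 -> short (proj v) = v.
Proof.
move=> hv; rewrite /short; case: xgetP => [w _ [ew hw]|/(_ v)[]//].
exact: short_unique ew hw hv.
Qed.

(** A curve that stays within [mu / 2] of its base point lies in a ball on which the
projection from [V] has a continuous section, by [short]. Shrinking this ball
linearly to its centre contracts the curve. *)
Lemma contractible_of_small (g : R -> T) : closed_curve g ->
  (forall t, t \in `[0, 1] -> torus_dist (g 0) (g t) < mu / 2) ->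
  contractible_curve g.
Proof.
move=> [gc g01] small; have [c ec] := torus_proj_surj (g 0).
have sh t : t \in `[0, 1] ->
    proj (short (g t - g 0)) = g t - g 0 /\ N (short (g t - g 0)) < mu / 2.
  move=> /small /torus_distC_lt /torus_dist_lt[v <- hv].
  by rewrite short_proj.
pose H (p : R * R) : T := proj (c + (1 - p.2) *: short (g p.1 - g 0)).
exists H, (g 0); split.
- apply/torus_within_continuousP => -[t0 s0] [t0I s0I] e e0.
  have [] := sh _ t0I; move Ea: (short (g t0 - g 0)) => a ea ha.
  pose d := Num.min (e / 2) (mu / 2 - N a).
  have d0 : 0 < d by rewrite lt_min divr_gt0 // subr_gt0.
  have ht : \forall q \near (t0, s0), q.1 \in `[0, 1] -> torus_dist (g t0) (g q.1) < d.
    move/torus_within_continuousP: gc => /(_ _ t0I _ d0) h.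
    exact: (@cvg_fst _ _ (nbhs t0) (nbhs s0) _ _ h).
  have hs : \forall q \near (t0, s0), `|s0 - q.2| < e / mu.
    have h : \forall s \near s0, `|s0 - s| < e / mu.
      by apply/nbhs_ballP; exists (e / mu) => //=; rewrite divr_gt0.
    exact: (@cvg_snd _ _ (nbhs t0) (nbhs s0) _ _ h).
  near=> q; move=> [qI1 qI2].
  have ht' : q.1 \in `[0, 1] -> torus_dist (g t0) (g q.1) < d by near: q.
  have /torus_dist_lt[b eb hb] := ht' qI1.
  have hs' : `|s0 - q.2| < e / mu by near: q.
  move: hb; rewrite lt_min => /andP[hb1 hb2].
  have eq : short (g q.1 - g 0) = a - b.
    rewrite (_ : g q.1 - g 0 = proj (a - b)) ?short_proj //.
      by rewrite (le_lt_trans (height_normB _ _)) // -ltrBrDl.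
    by rewrite torus_projB ea eb opprB [RHS]addrC subrKA.
  rewrite /H /= Ea eq; apply: le_lt_trans (torus_dist_proj _ _) _.
  have -> : c + (1 - s0) *: a - (c + (1 - q.2) *: (a - b)) =
      (q.2 - s0) *: a + (1 - q.2) *: b.
    exact: contraction_sub.
  apply: le_lt_trans (height_normD _ _) _.
  rewrite [e]splitr; apply: ltr_leD; rewrite height_normZ.
    have h0 := height_norm_ge0 a; rewrite distrC in hs'.
    apply: (@le_lt_trans _ _ (`|q.2 - s0| * (mu / 2))).
      by rewrite ler_wpM2l // ltW.
    by rewrite mulrA ltr_pM2r // -ltr_pdivlMr.
  have q01 : 0 <= q.2 <= 1 by [].
  rewrite ger0_norm; last by lra.
  by rewrite (le_trans _ (ltW hb1)) // ler_piMl ?height_norm_ge0 //; lra.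
- by move=> t tI; rewrite /H /= subr0 scale1r torus_projD ec (sh t tI).1 subrKC.
- by move=> t tI; rewrite /H /= subrr scale0r addr0 ec.
- by move=> s sI; rewrite /H /= -g01.
Unshelve. all: by end_near.
Qed.

End Torus.

(** * Lengths of closed curves in the height torus *)

(** Summing the relation of the cells over a row of the grid, the vertical terms
telescope to [vert j n - vert j 0], which vanishes, so all rows have the same
horizontal sum. *)
Lemma winding_invariant (V : zmodType) (n : nat) (hor vert : nat -> nat -> V) :
  (forall k j, (k < n)%N -> (j < n)%N ->
     hor j k + vert j k.+1 = vert j k + hor j.+1 k) ->
  (forall j, (j < n)%N -> vert j n = vert j 0%N) ->
  \sum_(k < n) hor 0%N k = \sum_(k < n) hor n k.
Proof.
move=> cell per.
suff W j : (j <= n)%N -> \sum_(k < n) hor 0%N k = \sum_(k < n) hor j k by exact: W.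
elim: j => // j IH jn; rewrite IH ?(ltnW jn) //.
apply/eqP; rewrite eq_sym -subr_eq0 -sumrB.
transitivity (\sum_(0 <= k < n) (vert j k.+1 - vert j k) == 0).
  rewrite big_mkord; congr (_ == 0); apply: eq_bigr => k _.
  by apply/eqP; rewrite subr_eq addrAC eq_sym subr_eq addrC cell // addrC.
by rewrite telescope_sumr // per // subrr eqxx.
Qed.

Section Curves.
Variables (R : realType) (E : elliptic_curve).
Local Notation V := (height_space R E).
Local Notation T := (height_torus R E).
Local Notation M := (mordell_weil E).
Local Notation N := (@height_norm R E).
Local Notation proj := (\pi_(Quotient.quot (@lattice R E)) : V -> T).
Implicit Types (x y z : T) (v w : V).

Lemma curve_length_ge (g : R -> T) (l : R) (s : seq R) :
  curve_length g = l%:E -> itv_partition 0 1 s -> polygonal_length g s <= l.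
Proof. by move=> e hs; rewrite -lee_fin -e; apply: ereal_sup_ubound; exists s. Qed.

(** Going from [g 0] to [g t] and back along the rest of the curve costs at most the
length. *)
Lemma closed_curve_dist (g : R -> T) (l : R) : closed_curve g ->
  curve_length g = l%:E -> forall t, t \in `[0, 1] -> torus_dist (g 0) (g t) <= l / 2.
Proof.
move=> [_ g01] el t; rewrite in_itv /= => /andP[t0 t1].
have l0 : 0 <= l.
  have := curve_length_ge (s := [:: 1]) el; rewrite /itv_partition /= ltr01 eqxx.
  move=> /(_ (conj isT isT)); apply: le_trans.
  by rewrite /polygonal_length /= big_nat1 torus_dist_ge0.
have [->|n0] := eqVneq t 0; first by rewrite torus_distxx divr_ge0.
have [->|n1] := eqVneq t 1; first by rewrite -g01 torus_distxx divr_ge0.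
have := curve_length_ge (s := [:: t; 1]) el; rewrite /itv_partition /= eqxx.
rewrite !lt_def n0 t0 eq_sym n1 t1 => /(_ (conj isT isT)).
rewrite /polygonal_length /= big_nat_recl // big_nat1 /= -g01 => h.
have sym : torus_dist (g t) (g 0) = torus_dist (g 0) (g t).
  by apply/eqP; rewrite eq_le !leNgt; apply/andP; split; apply/negP => lt;
     have := torus_distC_lt lt; rewrite ltxx.
by rewrite sym in h; lra.
Qed.

Definition geodesic v (t : R) : T := proj (t *: v).

Lemma geodesic_dist v s t : torus_dist (geodesic v s) (geodesic v t) <= `|s - t| * N v.
Proof. by rewrite (le_trans (torus_dist_proj _ _)) // -scalerBl height_normZ. Qed.

Lemma closed_geodesic v : v \in @lattice R E -> closed_curve (geodesic v).
Proof.
move=> hv; split; last first.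
  rewrite /geodesic scale0r scale1r; apply/torus_proj_eq.
  by rewrite sub0r rpredN.
apply/torus_within_continuousP => t _ e e0.
have b0 : 0 < N v + 1 by rewrite ltr_wpDl // height_norm_ge0.
apply/nbhs_ballP; exists (e / (N v + 1)) => /=; first by rewrite divr_gt0.
move=> s /= ts _; apply: le_lt_trans (geodesic_dist _ _ _) _.
apply: (@le_lt_trans _ _ (`|t - s| * (N v + 1))).
  by rewrite ler_wpM2l // lerDl.
by rewrite -ltr_pdivlMr.
Qed.

Lemma geodesic_length_le v : (curve_length (geodesic v) <= (N v)%:E)%E.
Proof.
apply: ge_ereal_sup => _ [s [ps /eqP ls] <-]; rewrite lee_fin /polygonal_length.
have step n : (n < size s)%N ->
    torus_dist (geodesic v (nth 1 (0 :: s) n)) (geodesic v (nth 1 s n)) <=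
    (nth 1 (0 :: s) n.+1 - nth 1 (0 :: s) n) * N v.
  move=> ns; apply: le_trans (geodesic_dist _ _ _) _.
  have lt := pathP 1 ps n ns.
  by rewrite distrC ger0_norm // subr_ge0 ltW.
apply: (@le_trans _ _ (\sum_(0 <= n < size s)
    (nth 1 (0 :: s) n.+1 - nth 1 (0 :: s) n) * N v)).
  by apply: ler_sum_nat => n /= ns; exact: step.
rewrite -mulr_suml telescope_sumr // (nth_last 1 (0 :: s)) /= ls subr0 mul1r //.
Qed.

Section Short.
Variable mu : R.
Hypothesis mu_gt0 : 0 < mu.
Hypothesis mu_le : forall P : M, P != 0 -> mu <= Num.sqrt (height R P).

(** A shorter closed curve stays in a ball of radius less than [mu / 2]. *)
Lemma noncontractible_length_ge (g : R -> T) (l : R) : closed_curve g ->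
  ~ contractible_curve g -> curve_length g = l%:E -> mu <= l.
Proof.
move=> cg nc el; rewrite leNgt; apply/negP => lt; apply: nc.
apply: (contractible_of_small mu_gt0 mu_le) => // t tI.
by rewrite (le_lt_trans (closed_curve_dist cg el tI)) // ltr_pM2r ?invr_gt0.
Qed.

Local Notation square := (`[0, 1]%classic `*` `[0, 1]%classic : set (R * R)).

(** Uniform continuity by compactness of the square; the uniform scale [d] is the
parameter of the covering argument. *)
Lemma uniform_on_square (H : R * R -> T) (e : R) : {within square, continuous H} ->
  0 < e -> exists2 d : R, 0 < d & forall p q, square p -> square q ->
    `|p.1 - q.1| < d -> `|p.2 - q.2| < d -> torus_dist (H p) (H q) < e.
Proof.
move=> /torus_within_continuousP cH e0.
have cpt : compact square by apply: compact_setX; exact: segment_compact.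
have := (iffLR (compact_near_coveringP square) cpt) R (0^'+)
  (fun d p => forall q, square p -> square q -> `|p.1 - q.1| < d ->
     `|p.2 - q.2| < d -> torus_dist (H p) (H q) < e) _.
case.
- move=> p sp; have e20 : 0 < e / 2 by rewrite divr_gt0.
  have /nbhs_ballP[eta /= eta0 heta] := cH p sp _ e20.
  have eta20 : 0 < eta / 2 by rewrite divr_gt0.
  exists (ball p (eta / 2), [set d | d < eta / 2]).
    by split; [exact: nbhsx_ballx|exact: nbhs_right_lt].
  move=> [p' d] [/= [b1 b2] hd] q sp' sq h1 h2.
  rewrite [e]splitr; apply: (@torus_dist_triangle_lt _ _ _ (H p)).
    apply/torus_distC_lt/heta => //; split.
      by apply: lt_le_trans b1 _; rewrite ler_pdivrMr // ler_peMr ?ler1n // ltW.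
    by apply: lt_le_trans b2 _; rewrite ler_pdivrMr // ler_peMr ?ler1n // ltW.
  apply: heta => //; rewrite [eta]splitr; split; rewrite /= /ball /=.
    by rewrite -(subrKA p'.1) (le_lt_trans (ler_normD _ _)) // ltrD // (lt_trans h1).
  by rewrite -(subrKA p'.2) (le_lt_trans (ler_normD _ _)) // ltrD // (lt_trans h2).
- move=> d /= d0 hd; exists (d / 2); first by rewrite divr_gt0.
  move=> p q sp sq; apply: (hd (d / 2)) => //=.
    by rewrite sub0r normrN gtr0_norm ?divr_gt0 // ltr_pdivrMr // ltr_pMr // ltr1n.
  by rewrite divr_gt0.
Qed.

Local Notation short := (@short R E mu).

Lemma short_sub x y : torus_dist x y < mu / 4 ->
  proj (short (x - y)) = x - y /\ N (short (x - y)) < mu / 4.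
Proof.
move=> /torus_dist_lt[v <- hv].
have h : N v < mu / 2 by apply: lt_trans hv _; move: mu_gt0; lra.
by rewrite (short_proj mu_le).
Qed.

Lemma short_add x y z : torus_dist x y < mu / 4 -> torus_dist y z < mu / 4 ->
  short (x - z) = short (x - y) + short (y - z).
Proof.
move=> /short_sub[e1 h1] /short_sub[e2 h2].
rewrite -(subrKA y) -{1}e1 -{1}e2 -torus_projD (short_proj mu_le) //.
apply: le_lt_trans (height_normD _ _) _.
by apply: lt_le_trans (ltrD h1 h2) _; lra.
Qed.

(** Discrete winding number. On a grid fine enough for the homotopy [H] to move less
than [mu / 4] along each edge, short lifts of the edges add up around every cell.
So the sum of the lifts along a row does not depend on the row. It is [v] for
the row of the geodesic, and 0 for the row where [H] is constant. *)
Lemma geodesic_noncontractible v : v \in @lattice R E ->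
  contractible_curve (geodesic v) -> v = 0.
Proof.
move=> hv [H [x [cH H0 H1 Hs]]].
have mu4 : 0 < mu / 4 by rewrite divr_gt0.
have [d d0 hd] := uniform_on_square cH mu4.
(* Steps of length [1 / n] are fine enough both for [H] and for the geodesic. *)
have [n n0 [nd nv]] : exists2 n : nat, (0 < n)%N &
    n%:R^-1 < d /\ n%:R^-1 * N v < mu / 2.
  exists (Num.truncn (Num.max d^-1 (2 * N v / mu))).+1 => //.
  set n := _.+1; have : Num.max d^-1 (2 * N v / mu) < n%:R by apply: truncnS_gt.
  have n0 : 0 < n%:R :> R by rewrite ltr0n.
  rewrite gt_max => /andP[h1 h2]; split; first by rewrite invf_plt ?posrE.
  rewrite mulrC ltr_pdivrMr // mulrAC ltr_pdivlMr // [_ * 2]mulrC [mu * _]mulrC.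
  by rewrite -ltr_pdivrMr.
have nR : n%:R != 0 :> R by rewrite pnatr_eq0 -lt0n.
pose c (k : nat) : R := k%:R / n%:R.
have c01 k : (k <= n)%N -> c k \in `[0, 1].
  by move=> kn; rewrite in_itv /= divr_ge0 //= ler_pdivrMr ?ltr0n // mul1r ler_nat.
have c0 : c 0%N = 0 by rewrite /c mul0r.
have cn : c n = 1 by rewrite /c divff.
have cS k : c k.+1 - c k = n%:R^-1 by rewrite /c -mulrBl -natrB // subSnn mul1r.
pose h k j := H (c k, c j).
have dh k j : (k < n)%N -> (j <= n)%N -> torus_dist (h k.+1 j) (h k j) < mu / 4.
  move=> kn jn; apply: hd => /=; try by split; apply: c01 => //; exact: ltnW.
    by rewrite cS ger0_norm // invr_ge0.
  by rewrite subrr normr0.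
have dv k j : (k <= n)%N -> (j < n)%N -> torus_dist (h k j.+1) (h k j) < mu / 4.
  move=> kn jn; apply: hd => /=; try by split; apply: c01 => //; exact: ltnW.
    by rewrite subrr normr0.
  by rewrite cS ger0_norm // invr_ge0.
have grid := @winding_invariant _ n (fun j k => short (h k.+1 j - h k j))
  (fun j k => short (h k j.+1 - h k j)).
have shn : short (proj (n%:R^-1 *: v)) = n%:R^-1 *: v.
  by apply: (short_proj mu_le); rewrite height_normZ ger0_norm ?invr_ge0.
have sh0 : short 0 = 0.
  have := short_proj mu_le (v := 0); rewrite torus_proj0 height_norm0; apply.
  by rewrite divr_gt0.
have : \sum_(k < n) short (h k.+1 0%N - h k 0%N) =
       \sum_(k < n) short (h k.+1 n - h k n).
  apply: grid => [k j kn jn|j jn].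
    transitivity (short (h k.+1 j.+1 - h k j)).
      by rewrite addrC; apply/esym/short_add; [exact: dv|apply: dh => //; exact: ltnW].
    by rewrite [RHS]addrC; apply: short_add; [exact: dh|apply: dv => //; exact: ltnW].
  by rewrite /h cn c0 -!Hs //; apply: c01 => //; exact: ltnW.
rewrite [RHS]big1 => [|k _]; last first.
  by rewrite /h cn !H1 ?c01 ?subrr // ltnW.
under eq_bigr => k _.
  rewrite /h c0 !H0 ?c01 ?(ltnW (ltn_ord k)) //.
  rewrite /geodesic -torus_projB -scalerBl cS shn; over.
rewrite sumr_const card_ord -scaler_nat scalerA divff // scale1r.
exact.
Qed.
End Short.
End Curves.

(** * Successive minima and the systole *)

Lemma finite_is_least (R : realType) (A : set R) (a : R) : A a ->
  finite_set (A `&` [set x | x <= a]) -> exists x, is_least A x.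
Proof.
move=> Aa /finite_seqP[s es].
have ins y : y \in s <-> A y /\ y <= a.
  by split=> [ys|[? ?]]; [have : [set` s] y by [] | change ([set` s] y)];
    rewrite -es.
pose m := \big[Order.min/a]_(y <- s) y.
have ms : m \in s.
  rewrite /m; have : {subset s <= s} by [].
  elim: {1 3}s => [|y t IH] sub; rewrite ?big_nil ?big_cons; first by apply/ins.
  rewrite minEle; case: ifP => _; first by apply: sub; rewrite mem_head.
  by apply: IH => z zt; apply: sub; rewrite in_cons zt orbT.
exists m; have [Am ma] := (ins m).1 ms; split=> // y Ay.
have [ya|/ltW ay] := leP y a; last exact: le_trans ma ay.
have ys : y \in s by apply/ins.
rewrite /m; elim: (s) ys => // z t IH; rewrite in_cons big_cons ge_min.
move=> /orP[/eqP->|/IH ->].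
  by rewrite lexx.
by rewrite orbT.
Qed.

Lemma is_least_unique (R : realType) (A : set R) (x y : R) :
  is_least A x -> is_least A y -> x = y.
Proof. by move=> [Ax lx] [Ay ly]; apply/eqP; rewrite eq_le lx // ly. Qed.

Lemma is_least_inf (R : realType) (A : set R) (x : R) :
  is_least A x -> is_least A (inf A).
Proof.
move=> [Ax lx]; suff -> : inf A = x by [].
apply/eqP; rewrite eq_le; apply/andP; split; last by apply: lb_le_inf => //; exists x.
by apply: ge_inf => //; exists x.
Qed.

(** [f] picks distinct members of the basis; a relation among them extends by zero to
a relation among all members. *)
Lemma basis_int_independent (M : zmodType) (r i : nat) (b : 'I_r -> M)
    (f : 'I_i -> 'I_r) :
  (forall P : M, exists! c : {ffun 'I_r -> int}, P = \sum_(j < r) b j *~ c j) ->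
  injective f -> int_independent (b \o f).
Proof.
move=> basis inj c c0 j.
pose c' : {ffun 'I_r -> int} := [ffun k => \sum_(l | f l == k) c l].
have [d [_ ud]] := basis 0.
have e1 : d = c'.
  apply: ud; rewrite -[LHS]c0 [LHS](partition_big f xpredT) //=; apply: eq_bigr => k _.
  by rewrite ffunE mulrz_sumr; apply: eq_bigr => l /eqP ->.
have e2 : d = [ffun=> 0].
  by apply: ud; rewrite big1 // => k _; rewrite ffunE mulr0z.
have : c' (f j) = 0 by rewrite -e1 e2 ffunE.
by rewrite ffunE (big_pred1 j) // => l /=; rewrite (inj_eq inj).
Qed.

Section Minima.
Variables (R : realType) (E : elliptic_curve).
Local Notation M := (mordell_weil E).

Definition independent_heights (i : nat) : set R :=
  [set H : R | exists P : 'I_i -> M,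
     int_independent P /\ forall j : 'I_i, height R (P j) <= H].

(** The threshold of a family may be lowered to the largest height of its members,
and by Northcott only finitely many heights lie below a given bound. *)
Lemma independent_heights_least (i : nat) (P : 'I_i.+1 -> M) :
  int_independent P -> exists2 H, 0 <= H & is_least (independent_heights i.+1) H.
Proof.
move=> indP.
pose A := independent_heights i.+1 `&` range (height R (E := E)).
have down H : independent_heights i.+1 H -> exists2 H', A H' & H' <= H.
  move=> [Q [indQ QH]].
  have [j _ hj] := arg_maxP (fun j => height R (Q j))
    (isT : xpredT (ord0 : 'I_i.+1)).
  exists (height R (Q j)) => //; split; last by exists (Q j).
  by exists Q; split => // l; exact: hj.
have [H AH _] : exists2 H, A H & H <= \sum_j height R (P j).
  apply: down; exists P; split=> // j; rewrite (bigD1 j) //= lerDl.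
  by apply: sumr_ge0 => l _; exact: height_ge0.
have [|H0 [[AH0 [Q _ eQ]] lH0]] := finite_is_least AH.
  apply: sub_finite_set (finite_image (height R (E := E)) (finite_height E H)).
  by move=> _ [[_ [Q _ <-]] QH]; exists Q.
exists H0; first by rewrite -eQ height_ge0.
split=> // K /down[K' AK' KK']; exact: le_trans (lH0 _ AK') KK'.
Qed.

(** Lattice vectors are the images of classes, squared norms are heights, and
independence over the reals is independence over the integers. *)
Lemma minimum_radiiE (r i : nat) (l : R) : mordell_weil_rank E r ->
  minimum_radii E i.+1 l <-> 0 <= l /\ independent_heights i.+1 (l ^+ 2).
Proof.
move=> [b basis].
have sq (P : M) : 0 <= l ->
    (height_norm (realify R P : height_space R E) <= l) = (height R P <= l ^+ 2).
  move=> l0; rewrite height_norm_realify -{2}(sqr_sqrtr (height_ge0 R P)).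
  by rewrite ler_pXn2r // nnegrE ?sqrtr_ge0.
split=> [[u [indu ul uN]]|[l0 [P [indP PH]]]].
  have l0 : 0 <= l by apply: le_trans (uN ord0); exact: height_norm_ge0.
  split=> //.
  have /choice[P eP] : forall j, exists p, u j = realify R p.
    by move=> j; apply/asboolP; exact: ul.
  exists P; split; last by move=> j; rewrite -sq // -eP.
  apply: (@int_independent_realify R).
  by rewrite (_ : (fun j => _) = u) //; apply/funext => j; rewrite eP.
exists (fun j => realify R (P j)); split.
- exact: (lin_independent_realify basis).
- by move=> j; apply/asboolP; exists (P j).
- by move=> j; rewrite sq.
Qed.

Lemma minimum_radii_least (r i : nat) (H : R) : mordell_weil_rank E r -> 0 <= H ->
  is_least (independent_heights i.+1) H ->
  is_least (minimum_radii E i.+1) (successive_minimum R E i.+1) /\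
  successive_minimum R E i.+1 ^+ 2 = H.
Proof.
move=> rk H0 [AH lH].
have least : is_least (minimum_radii E i.+1) (Num.sqrt H).
  split; first by apply/(minimum_radiiE _ _ rk); rewrite sqrtr_ge0 sqr_sqrtr.
  move=> l /(minimum_radiiE _ _ rk)[l0 /lH]; rewrite -{1}(sqr_sqrtr H0).
  by rewrite ler_pXn2r // nnegrE sqrtr_ge0.
have := is_least_inf least; rewrite -/(successive_minimum R E i.+1) => least'.
by split=> //; rewrite (is_least_unique least' least) sqr_sqrtr.
Qed.

Lemma int_independent1 (P : 'I_1 -> M) : int_independent P <-> P ord0 != 0.
Proof.
split=> [ind|P0 c].
  apply/eqP => P0; have : (1 : int) = 0; last by [].
  by apply: (ind (fun=> 1)) ord0; rewrite big_ord1 P0 mul0rz.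
rewrite big_ord1 => c0 j; rewrite ord1; apply: contra_neq_eq P0 => /eqP cn0.
apply: (@mordell_weil_torsion_free E _ `|c ord0|%N).
  by rewrite absz_gt0; apply/eqP.
move: c0; case: (c ord0) => n //= /eqP; rewrite NegzE mulrNz oppr_eq0 => /eqP <-.
by [].
Qed.

Lemma nonzero_height_least (H : R) : is_least (independent_heights 1) H ->
  is_least [set height R P | P in [set P : M | P != 0]] H.
Proof.
move=> [[P [/int_independent1 P0 PH]] lH].
have low (Q : M) : Q != 0 -> H <= height R Q.
  by move=> Q0; apply: lH; exists (fun=> Q); split=> //; apply/int_independent1.
split; last by move=> _ [Q Q0 <-]; exact: low.
by exists (P ord0) => //; apply/eqP; rewrite eq_le PH low.
Qed.

(** The projection of the segment from 0 to a shortest nonzero lattice vector is not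
contractible, and no noncontractible closed curve is shorter than that vector. *)
Lemma systole_least (H : R) :
  is_least [set height R P | P in [set P : M | P != 0]] H ->
  is_least (noncontractible_lengths E) (systole R E) /\ systole R E ^+ 2 = H.
Proof.
move=> [[P P0 PH] lH].
have H0 : 0 < H.
  by rewrite -PH lt_def height_ge0 andbT; apply: contra_neq P0 => /height_eq0.
have mu_gt0 : 0 < Num.sqrt H by rewrite sqrtr_gt0.
have mu_le (Q : M) : Q != 0 -> Num.sqrt H <= Num.sqrt (height R Q).
  by move=> Q0; rewrite ler_wsqrtr // lH //; exists Q.
pose v : height_space R E := realify R P.
have vN : height_norm v = Num.sqrt H by rewrite height_norm_realify PH.
have vL : v \in @lattice R E by apply/asboolP; exists P.
have cv := closed_geodesic vL.
have ncv : ~ contractible_curve (geodesic v).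
  move=> /(geodesic_noncontractible mu_gt0 mu_le vL) v0.
  by move: mu_gt0; rewrite -vN v0 height_norm0 ltxx.
have low : lbound (noncontractible_lengths E) (Num.sqrt H).
  by move=> l [g [cg ng gl]]; exact: (noncontractible_length_ge mu_gt0 mu_le cg ng gl).
have vlen : curve_length (geodesic v) = (Num.sqrt H)%:E.
  have up := geodesic_length_le v; rewrite vN in up.
  have ge0 : (0%:E <= curve_length (geodesic v))%E.
    apply: (@le_trans _ _ (polygonal_length (geodesic v) [:: 1])%:E).
      by rewrite lee_fin sumr_ge0 // => n _; exact: torus_dist_ge0.
    by apply: ereal_sup_ubound; exists [:: 1] => //; split=> //=; rewrite ltr01.
  have fin : curve_length (geodesic v) \is a fin_num.
    by rewrite ge0_fin_numE // (le_lt_trans up) // ltry.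
  rewrite -(fineK fin); congr (_%:E); apply/eqP; rewrite eq_le.
  rewrite -lee_fin fineK // up /=; apply: low; exists (geodesic v); split=> //.
  by rewrite fineK.
have least : is_least (noncontractible_lengths E) (Num.sqrt H).
  by split=> //; exists (geodesic v).
have := is_least_inf least; rewrite -/(systole R E) => least'.
by split=> //; rewrite (is_least_unique least' least) sqr_sqrtr // ltW.
Qed.
End Minima.

Theorem theorem6p2 (R : realType) (E : elliptic_curve) (r : nat)
    (r_gt0 : (0 < r)%N) (rankE : mordell_weil_rank E r) :
  [/\ is_least (noncontractible_lengths E) (systole R E),
      is_least [set height R P | P in [set P : mordell_weil E | P != 0]]
        (systole R E ^+ 2),
      systole R E ^+ 2 = successive_minimum R E 1 ^+ 2
    & forall i : nat, (1 <= i <= r)%N ->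
        is_least (minimum_radii E i) (successive_minimum R E i) /\
        is_least
          [set H : R | exists P : 'I_i -> mordell_weil E,
             int_independent P /\ forall j : 'I_i, height R (P j) <= H]
          (successive_minimum R E i ^+ 2)].
Proof.
have minima i : (i < r)%N -> exists H : R,
    [/\ is_least (independent_heights E i.+1) H,
        is_least (minimum_radii E i.+1) (successive_minimum R E i.+1) &
        successive_minimum R E i.+1 ^+ 2 = H].
  move=> ir; have [b basis] := rankE.
  have indb : int_independent (b \o widen_ord ir).
    by apply: basis_int_independent basis _ => j k /(congr1 val) /= /val_inj.
  have [H H0 leastH] := independent_heights_least R indb.
  by exists H; have [] := minimum_radii_least rankE H0 leastH.
have [H [leastH _ eH]] := minima 0%N r_gt0.
have leastP := nonzero_height_least leastH.
have [leastS eS] := systole_least leastP.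
split=> //; [by rewrite eS|by rewrite eS eH|].
case=> // i /= ir; have [H' [leastH' leastR eH']] := minima i ir.
by split=> //; rewrite eH'.
Qed.
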